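(* Let $\mathfrak{L}$ be a computable language, let $C$ be a $\Delta_2$ cohesive set, and let $n \in \mathbb{N}$. (1) Let $(\mathcal{A}_i : i \in \mathbb{N})$ be a uniformly $n$-decidable sequence of $\mathfrak{L}$-structures. Then $\prod_C \mathcal{A}_i$ realizes every computable $\Sigma_{n+1}$-type over a uniformly partial computable sequence of parameters. In particular, $\prod_C \mathcal{A}_i$ is $\Sigma_{n+1}$-recursively saturated. (2) Let $\mathcal{A}$ be an $n$-decidable $\mathfrak{L}$-structure. Then $\prod_C \mathcal{A}$ realizes every computable $\Sigma_{n+1}$-type over a uniformly partial computable sequence of parameters. In particular, $\prod_C \mathcal{A}$ is $\Sigma_{n+1}$-recursively saturated.
   Context: $\Delta_2$ (for subsets of $\mathbb{N}$) refers to the arithmetical hierarchy; c.e. means computably enumerable. $X \subseteq^* Y$ means that $X \setminus Y$ is finite. A set $C \subseteq \mathbb{N}$ is cohesive if it is infinite and for every c.e. set $W$, either $C \subseteq^* W$ or $C \subseteq^* \mathbb{N} \setminus W$. A uniformly computable sequence of $\mathfrak{L}$-structures $(\mathcal{A}_i : i \in \mathbb{N})$ consists of a uniformly computable sequence of non-empty domains $|\mathcal{A}_i| \subseteq \mathbb{N}$ with uniformly computable interpretations of all symbols of $\mathfrak{L}$; equivalently, the atomic diagrams are uniformly computable. A structure is computable if its atomic diagram is computable (with domain a computable subset of $\mathbb{N}$). A computable structure is $n$-decidable if its $\Sigma_n$-elementary diagram is computable; a uniformly computable sequence of structures is uniformly $n$-decidable if the corresponding sequence of $\Sigma_n$-elementary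 diagrams is uniformly computable. ($0$-decidable is the same as computable.) Cohesive product: let $(\mathcal{A}_i : i \in \mathbb{N})$ be a uniformly computable sequence of $\mathfrak{L}$-structures and $C$ a cohesive set. Let $D$ be the set of partial computable functions $\varphi$ such that $\varphi(i) \in |\mathcal{A}_i|$ whenever $\varphi(i)\downarrow$, and $C \subseteq^* \mathrm{dom}(\varphi)$. For $\varphi,\psi \in D$ let $\varphi =_C \psi$ if $C \subseteq^* \{i : \varphi(i)\downarrow = \psi(i)\downarrow\}$, an equivalence relation with classes $[\varphi]$. The cohesive product $\prod_C \mathcal{A}_i$ is the $\mathfrak{L}$-structure with domain $\{[\varphi] : \varphi \in D\}$, in which: a relation $R([\varphi_0], \dots, [\varphi_{m-1}])$ holds iff $C \subseteq^* \{i : \mathcal{A}_i \models R(\varphi_0(i), \dots, \varphi_{m-1}(i))\}$ (including that all $\varphi_j(i)\downarrow$); $f([\varphi_0], \dots, [\varphi_{m-1}]) = [\psi]$ where $\psi(i) \simeq f^{\mathcal{A}_i}(\varphi_0(i), \dots, \varphi_{m-1}(i))$; and a constant $c$ is interpreted as the class of $i \mapsto c^{\mathcal{A}_i}$. If every $\mathcal{A}_i$ is the same computable structure $\mathcal{A}$, this is the cohesive power $\prod_C \mathcal{A}$. Types: let $\mathcal{M}$ be an $\mathfrak{L}$-structure and $E \subseteq |\mathcal{M}|$ a set of parameters, enumerated as a finite or infinite sequence and named by fresh constant symbols. A type of $\mathcal{M}$ over $E$ is a set $p(\vec{x})$ of formulas with parameters from $E$ in fixed finitely many free variables $\vec{x}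 = x_0, \dots, x_{m-1}$ that is finitely satisfied in $\mathcal{M}$. It is realized if there is a tuple $\vec{a}$ from $|\mathcal{M}|$ with $\mathcal{M} \models \Phi(\vec{a})$ for all $\Phi \in p$. It is a $\Sigma_k$-type if every formula in it is $\Sigma_k$, and it is computable if it is computable as a set of formulas (with the constants for the parameters indexed by their position in the enumeration). $\mathcal{M}$ is $\Sigma_k$-recursively saturated if it realizes every computable $\Sigma_k$-type over a finite set of parameters. A sequence $([\psi_\ell] : \ell \in \mathbb{N})$ of elements of a cohesive product is uniformly partial computable if the sequence of representatives $(\psi_\ell : \ell \in \mathbb{N})$ is uniformly partial computable. *)

(* Defs.v *)
From HB Require Import structures.
From mathcomp Require Import all_boot.
From mathcomp Require Import boolp classical_sets functions cardinality.

Set Implicit Arguments.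
Unset Strict Implicit.
Unset Printing Implicit Defensive.

Local Open Scope classical_set_scope.
Local Open Scope quotient_scope.

(* The tuple of the values of [t], provided that they are all defined. *)
Definition otuple (T : Type) (k : nat) (t : k.-tuple (option T)) :
    option (k.-tuple T) :=
  insub (pmap id t).

(* [f t = None] means that [f] diverges at [t]. *)
Definition pfun (k : nat) := k.-tuple nat -> option nat.

Definition pcomposition k m (f : pfun k) (g : 'I_k -> pfun m) : pfun m :=
  fun t => obind f (otuple [tuple g i t | i < k]).

Definition primrec k (f : pfun k) (g : pfun k.+2) : pfun k.+1 := fun t =>
  let s := [tuple of behead t] in
  (fix h n := match n with
   | 0 => f s
   | n'.+1 => obind (fun y => g [tuple of n' :: y :: s]) (h n')
   end) (thead t).

Definition is_minimization k (f : pfun k.+1) (h : pfun k) :=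
  forall t y, h t = Some y <->
    f [tuple of y :: t] = Some 0 /\
    forall z, z < y -> exists w, f [tuple of z :: t] = Some w.+1.

Inductive partial_computable : forall k, pfun k -> Prop :=
| pc_zero : partial_computable (fun _ : 0.-tuple nat => Some 0)
| pc_succ : partial_computable (fun t : 1.-tuple nat => Some (thead t).+1)
| pc_proj k (i : 'I_k) :
    partial_computable (fun t : k.-tuple nat => Some (tnth t i))
| pc_comp k m (f : pfun k) (g : 'I_k -> pfun m) :
    partial_computable f -> (forall i, partial_computable (g i)) ->
    partial_computable (pcomposition f g)
| pc_primrec k (f : pfun k) (g : pfun k.+2) :
    partial_computable f -> partial_computable g ->
    partial_computable (primrec f g)
| pc_min k (f : pfun k.+1) (h : pfun k) :
    partial_computable f -> is_minimization f h -> partial_computable h.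

Definition computable k (f : k.-tuple nat -> nat) :=
  partial_computable (fun t => Some (f t)).

Definition computable_rel k (P : k.-tuple nat -> Prop) :=
  computable (fun t => `[< P t >] : nat).

Definition unary T (f : nat -> T) (t : 1.-tuple nat) := f (nth 0 t 0).
Definition binary T (f : nat -> nat -> T) (t : 2.-tuple nat) :=
  f (nth 0 t 0) (nth 0 t 1).
Definition ternary T (f : nat -> nat -> nat -> T) (t : 3.-tuple nat) :=
  f (nth 0 t 0) (nth 0 t 1) (nth 0 t 2).

Definition ce (W : set nat) :=
  exists2 f : nat -> option nat,
    partial_computable (unary f) & W = [set x | f x].

Definition Sigma2 (X : set nat) :=
  exists2 R : nat -> nat -> nat -> Prop, computable_rel (ternary R) &
    forall x, X x <-> exists y, forall z, R x y z.

Definition Pi2 (X : set nat) :=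
  exists2 R : nat -> nat -> nat -> Prop, computable_rel (ternary R) &
    forall x, X x <-> forall y, exists z, R x y z.

Definition Delta2 (X : set nat) := Sigma2 X /\ Pi2 X.

Definition almost_subset (X Y : set nat) := finite_set (X `\` Y).

Definition cohesive (C : set nat) :=
  infinite_set C /\
  forall W, ce W -> almost_subset C W \/ almost_subset C (~` W).

(* Constants are function symbols of arity 0. *)
Record language := Language {
  fsym : countType;
  far : fsym -> nat;
  rsym : countType;
  rar : rsym -> nat }.
Arguments far {l}.
Arguments rar {l}.

(* Symbols are coded by [pickle]; the functions below give at once the set of
   codes of symbols and the arity of the coded symbol. *)
Definition computable_language (L : language) :=
  computable (unary (fun x =>
    if @pickle_inv (fsym L) x is Some f then (far f).+1 else 0)) /\
  computable (unary (fun x =>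
    if @pickle_inv (rsym L) x is Some r then (rar r).+1 else 0)).

Record structure (L : language) := Structure {
  carrier :> Type;
  fint : forall f : fsym L, (far f).-tuple carrier -> carrier;
  rint : forall r : rsym L, (rar r).-tuple carrier -> Prop }.

(* Terms and formulas of the language [L] expanded by one fresh constant for
   each element of [K], with free variables among x_0, ..., x_{m-1}.  Bound
   variables are de Bruijn indices: below a quantifier, x_0 is the quantified
   variable and the former x_i is x_{i+1}. *)
Inductive term (L : language) (K : Type) (m : nat) : Type :=
| Var of 'I_m
| Cst of K
| App (f : fsym L) of ('I_(far f) -> term L K m).

Inductive formula (L : language) (K : Type) (m : nat) : Type :=
| Eq of term L K m & term L K m
| Rel (r : rsym L) of ('I_(rar r) -> term L K m)
| Not of formula L K m
| And of formula L K m & formula L K m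
| Or of formula L K m & formula L K m
| Ex of formula L K m.+1
| All of formula L K m.+1.

Section Semantics.
Variables (L : language) (K : Type) (M : structure L) (par : K -> M).

Fixpoint eval m (e : m.-tuple M) (t : term L K m) : M :=
  match t with
  | Var i => tnth e i
  | Cst c => par c
  | App f ts => fint [tuple eval e (ts i) | i < far f]
  end.

Fixpoint sat m (e : m.-tuple M) (A : formula L K m) : Prop :=
  match A with
  | Eq t u => eval e t = eval e u
  | Rel r ts => rint [tuple eval e (ts i) | i < rar r]
  | Not A => ~ sat e A
  | And A B => sat e A /\ sat e B
  | Or A B => sat e A \/ sat e B
  | Ex A => exists a, sat [tuple of a :: e] A
  | All A => forall a, sat [tuple of a :: e] A
  end.

End Semantics.

Fixpoint qfree L K m (A : formula L K m) : bool :=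
  match A with
  | Eq _ _ | Rel _ _ => true
  | Not A => qfree A
  | And A B | Or A B => qfree A && qfree B
  | Ex _ | All _ => false
  end.

(* Prenex formulas whose quantifier prefix has [n] alternating, possibly empty,
   blocks, the outermost one being existential (resp. universal). *)
Inductive is_Sigma L K : nat -> forall m, formula L K m -> Prop :=
| Sigma_qfree m (A : formula L K m) : qfree A -> is_Sigma 0 A
| Sigma_Pi n m (A : formula L K m) : is_Pi n A -> is_Sigma n.+1 A
| Sigma_Ex n m (A : formula L K m.+1) : is_Sigma n.+1 A -> is_Sigma n.+1 (Ex A)
with is_Pi L K : nat -> forall m, formula L K m -> Prop :=
| Pi_qfree m (A : formula L K m) : qfree A -> is_Pi 0 A
| Pi_Sigma n m (A : formula L K m) : is_Sigma n A -> is_Pi n.+1 A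
| Pi_All n m (A : formula L K m.+1) : is_Pi n.+1 A -> is_Pi n.+1 (All A).

(* Goedel numbers, relative to a numbering [kc] of the added constants;
   [CodeSeq.code] is a computable bijection from [seq nat] to [nat]. *)
Section Goedel.
Variables (L : language) (K : Type) (kc : K -> nat).

Fixpoint gterm m (t : term L K m) : nat :=
  match t with
  | Var i => CodeSeq.code [:: 0; i : nat]
  | Cst c => CodeSeq.code [:: 1; kc c]
  | App f ts =>
      CodeSeq.code [:: 2, pickle f & [seq gterm (ts i) | i <- enum 'I_(far f)]]
  end.

Fixpoint gform m (A : formula L K m) : nat :=
  match A with
  | Eq t u => CodeSeq.code [:: 0; gterm t; gterm u]
  | Rel r ts =>
      CodeSeq.code [:: 1, pickle r & [seq gterm (ts i) | i <- enum 'I_(rar r)]]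
  | Not A => CodeSeq.code [:: 2; gform A]
  | And A B => CodeSeq.code [:: 3; gform A; gform B]
  | Or A B => CodeSeq.code [:: 4; gform A; gform B]
  | Ex A => CodeSeq.code [:: 5; gform A]
  | All A => CodeSeq.code [:: 6; gform A]
  end.

End Goedel.
Arguments gterm {L K} kc {m} t.
Arguments gform {L K} kc {m} A.

(* Structures whose domain is a non-empty subset of [nat]. *)
Record nat_structure (L : language) := NatStructure {
  dom : pred nat;
  dom_nonempty : exists a, dom a;
  nfint : forall f : fsym L, (far f).-tuple {a | dom a} -> {a | dom a};
  nrint : forall r : rsym L, (rar r).-tuple {a | dom a} -> Prop }.

Coercion structure_of L (A : nat_structure L) : structure L :=
  Structure (@nfint L A) (@nrint L A).

Definition value L (A : nat_structure L) (a : A) : nat := val a.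

Definition code_tuple L (A : nat_structure L) k (t : k.-tuple A) : nat :=
  CodeSeq.code [seq value a | a <- t].

Definition uniformly_computable L (A : nat -> nat_structure L) :=
  [/\ computable_rel (binary (fun i a => dom (A i) a)),
      (exists2 F : nat -> nat -> nat -> nat, computable (ternary F) &
        forall i (f : fsym L) (t : (far f).-tuple (A i)),
          F i (pickle f) (code_tuple t) = value (fint t)) &
      (exists2 R : nat -> nat -> nat -> Prop, computable_rel (ternary R) &
        forall i (r : rsym L) (t : (rar r).-tuple (A i)),
          R i (pickle r) (code_tuple t) <-> rint t)].

Definition computable_structure L (A : nat_structure L) :=
  [/\ computable_rel (unary (fun a => dom A a)),
      (exists2 F : nat -> nat -> nat, computable (binary F) &
        forall (f : fsym L) (t : (far f).-tuple A),
          F (pickle f) (code_tuple t) = value (fint t)) &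
      (exists2 R : nat -> nat -> Prop, computable_rel (binary R) &
        forall (r : rsym L) (t : (rar r).-tuple A),
          R (pickle r) (code_tuple t) <-> rint t)].

(* The Goedel numbers of the Sigma_n sentences, with a constant for each element
   of the domain of [A], that are true in [A]. *)
Definition elementary_diagram L (n : nat) (A : nat_structure L) : set nat :=
  gform (@value L A) @`
    [set P : formula L A 0 | is_Sigma n P /\ sat id [tuple] P].

Definition uniformly_n_decidable L (n : nat) (A : nat -> nat_structure L) :=
  uniformly_computable A /\
  computable_rel (binary (fun i => elementary_diagram n (A i))).

Definition n_decidable L (n : nat) (A : nat_structure L) :=
  computable_structure A /\ computable_rel (unary (elementary_diagram n A)).

Section Types.
Variables (L : language) (M : structure L).

Definition is_type (K : Type) (par : K -> M) m (p : set (formula L K m)) :=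
  forall s : set (formula L K m), finite_set s -> s `<=` p ->
    exists a : m.-tuple M, forall P, s P -> sat par a P.

Definition realized (K : Type) (par : K -> M) m (p : set (formula L K m)) :=
  exists a : m.-tuple M, forall P, p P -> sat par a P.

Definition Sigma_type (K : Type) (k m : nat) (p : set (formula L K m)) :=
  forall P, p P -> is_Sigma k P.

Definition computable_type (K : Type) (kc : K -> nat) m
    (p : set (formula L K m)) :=
  computable_rel (unary (gform kc @` p)).

Definition realizes_computable_Sigma_types (k : nat) (K : Type)
    (kc : K -> nat) (par : K -> M) :=
  forall m (p : set (formula L K m)),
    is_type par p -> Sigma_type k p -> computable_type kc p -> realized par p.

Definition Sigma_recursively_saturated (k : nat) :=
  forall N (par : 'I_N -> M),
    realizes_computable_Sigma_types k (@nat_of_ord N) par.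

End Types.

Lemma otuple_some T k (t : k.-tuple T) :
  otuple [tuple of map some t] = Some t.
Proof.
rewrite /otuple.
have -> : pmap id [tuple of map some t] = t :> seq T.
  by case: t => s /= _; elim: s => //= x s ->.
by rewrite valK.
Qed.

Lemma otuple_inv T k (t : k.-tuple (option T)) (s : k.-tuple T) :
  otuple t = Some s -> t = [tuple of map some s].
Proof.
rewrite /otuple; case: insubP => //= u _ us [us']; apply: val_inj => /=.
rewrite -us' us.
have : size (pmap id t) = size t by rewrite -us !size_tuple.
case: (t) => /= l _; elim: l => //= -[x|] l ih /=.
  by case=> /ih <-.
move=> h; have : size (pmap id l) <= size l by rewrite size_pmap count_size.
by rewrite h ltnn.
Qed.

Lemma otuple_omap T U (g : T -> U) k (t : k.-tuple (option T)) :
  otuple [tuple of map (omap g) t] =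
  omap (fun s : k.-tuple T => [tuple of map g s]) (otuple t).
Proof.
case E: (otuple t) => [s|] /=.
  rewrite (otuple_inv E) -[RHS]otuple_some; congr otuple.
  by apply: val_inj => /=; rewrite -!map_comp.
case E': otuple => [s|] //; have /(congr1 val) /= h := otuple_inv E'.
suff [s' ts] : exists s' : seq T, val t = map some s'.
  have sz : size s' == k by rewrite -(size_map some) -ts size_tuple.
  have tE : t = [tuple of map some (Tuple sz)] by apply: val_inj.
  by rewrite tE otuple_some in E.
clear -h; case: t s h => l /= _ [s /= _].
elim: l s => [|[x|] l ih] [|y s] //=; first by exists [::].
by case=> _ /ih [s' ->]; exists (x :: s').
Qed.

Lemma pc_comp_total k m (f : pfun k) (g : 'I_k -> m.-tuple nat -> nat) :
  partial_computable f -> (forall i, computable (g i)) ->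
  partial_computable (fun t => f [tuple g i t | i < k]).
Proof.
move=> pf pg.
suff -> : (fun t => f [tuple g i t | i < k]) =
    pcomposition f (fun i t => Some (g i t)) by apply: pc_comp.
apply/funext => t; rewrite /pcomposition.
suff -> : [tuple Some (g i t) | i < k] =
    [tuple of map some [tuple g i t | i < k]] by rewrite otuple_some.
by apply: eq_from_tnth => i; rewrite tnth_map !tnth_mktuple.
Qed.

Lemma nth_mktuple T (x : T) k (f : 'I_k -> T) i (ik : i < k) :
  nth x [tuple f j | j < k] i = f (Ordinal ik).
Proof. by have := tnth_nth x [tuple f j | j < k] (Ordinal ik); rewrite tnth_mktuple. Qed.

Lemma computable_const k (c : nat) : computable (fun _ : k.-tuple nat => c).
Proof.
rewrite /computable; elim: c => [|c ih].
  by apply: (pc_comp_total (g := fun i t => 0) pc_zero) => -[].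
have := pc_comp_total (g := fun i t => c) pc_succ (fun=> ih).
by congr partial_computable; apply/funext => t; rewrite /thead tnth_mktuple.
Qed.

Lemma pc_unary k (f : nat -> option nat) (g : k.-tuple nat -> nat) :
  partial_computable (unary f) -> computable g ->
  partial_computable (fun t => f (g t)).
Proof.
move=> pf pg; have := pc_comp_total (g := fun=> g) pf (fun=> pg).
by congr partial_computable; apply/funext => t; rewrite /unary nth_mktuple.
Qed.

Lemma pc_binary k (f : nat -> nat -> option nat) (g h : k.-tuple nat -> nat) :
  partial_computable (binary f) -> computable g -> computable h ->
  partial_computable (fun t => f (g t) (h t)).
Proof.
move=> pf pg ph; pose F (i : 'I_2) := if i == 0 :> nat then g else h.
have := pc_comp_total (g := F) pf; rewrite /F => pF.
have {pF}/pF : forall i : 'I_2, computable (if i == 0 :> nat then g else h).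
  by move=> i; case: ifP.
by congr partial_computable; apply/funext => t; rewrite /binary !nth_mktuple.
Qed.

Lemma computable_proj k i (ik : i < k) :
  computable (fun t : k.-tuple nat => nth 0 t i).
Proof.
have := pc_proj (Ordinal ik); congr partial_computable; apply/funext => t.
by rewrite ?/thead (tnth_nth 0).
Qed.

Lemma computable_primrec1 (f : nat -> nat) (c : nat) (g : nat -> nat -> nat) :
  computable (binary g) -> f 0 = c -> (forall n, f n.+1 = g n (f n)) ->
  computable (unary f).
Proof.
move=> pg f0 fS.
have := pc_primrec (computable_const 0 c) pg.
congr partial_computable; apply/funext => t.
rewrite /primrec /unary /thead (tnth_nth 0) /=; elim: (nth 0 t 0) => [|n ih].
  by rewrite f0.
by rewrite ih /= fS.
Qed.

Lemma computable_primrec2 (f : nat -> nat -> nat) (b : nat -> nat)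
    (g : nat -> nat -> nat -> nat) :
  computable (unary b) -> computable (ternary g) ->
  (forall x, f 0 x = b x) -> (forall n x, f n.+1 x = g n (f n x) x) ->
  computable (binary f).
Proof.
move=> pb pg f0 fS.
have := pc_primrec pb pg.
congr partial_computable; apply/funext => t.
rewrite /primrec /binary /thead (tnth_nth 0) /=; elim: (nth 0 t 0) => [|n ih].
  by rewrite f0 /unary /= nth_behead.
by rewrite ih /= fS /ternary /= nth_behead.
Qed.

Lemma computable_unary k (f : nat -> nat) (g : k.-tuple nat -> nat) :
  computable (unary f) -> computable g -> computable (fun t => f (g t)).
Proof. exact: (@pc_unary k (Some \o f)). Qed.

Lemma computable_binary k (f : nat -> nat -> nat) (g h : k.-tuple nat -> nat) :
  computable (binary f) -> computable g -> computable h ->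
  computable (fun t => f (g t) (h t)).
Proof. exact: (@pc_binary k (fun x y => Some (f x y))). Qed.

Lemma computable_succn : computable (unary succn).
Proof.
have := pc_succ; congr partial_computable; apply/funext => t.
by rewrite ?/thead (tnth_nth 0).
Qed.

Lemma computable_addn : computable (binary addn).
Proof.
apply: (computable_primrec2 (b := id) (g := fun _ y _ => y.+1)) => //.
  exact: (@computable_proj 1 0).
by apply: (computable_unary computable_succn); apply: computable_proj.
Qed.

Lemma computable_muln : computable (binary muln).
Proof.
apply: (computable_primrec2 (b := fun=> 0) (g := fun _ y x => x + y)) => //.
  exact: computable_const.
by apply: (computable_binary computable_addn); apply: computable_proj.
Qed.

Lemma computable_code_cons : computable (binary (fun n m => 2 ^ n * m.*2.+1)).
Proof.
have pexp : computable (unary (expn 2)).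
  apply: (computable_primrec1 (c := 1) (g := fun _ y => 2 * y)) => //; last first.
    exact: expnS.
  apply: (computable_binary computable_muln); first exact: computable_const.
  exact: computable_proj.
have pdbl : computable (unary (fun m => m.*2.+1)).
  apply: (computable_unary computable_succn).
  rewrite (_ : (fun t => _) = fun t : 1.-tuple nat => nth 0 t 0 + nth 0 t 0).
    by apply: (computable_binary computable_addn); apply: computable_proj.
  by apply/funext => t; rewrite addnn.
apply: (computable_binary computable_muln).
  by apply: (computable_unary pexp); apply: computable_proj.
by apply: (computable_unary pdbl); apply: computable_proj.
Qed.

Lemma computable_code k : computable (fun t : k.-tuple nat => CodeSeq.code t).
Proof.
rewrite (_ : (fun t => _) = fun t : k.-tuple nat =>
    CodeSeq.code [seq tnth t i | i <- enum 'I_k]); last first.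
  by apply/funext => t; rewrite map_tnth_enum.
elim: (enum _) => [|i s ih] /=; first exact: computable_const.
by apply: (computable_binary computable_code_cons) ih; apply: pc_proj.
Qed.

Lemma pc_omap (f : nat -> nat -> nat) (h : nat -> option nat) :
  computable (binary f) -> partial_computable (unary h) ->
  partial_computable (unary (fun i => omap (f i) (h i))).
Proof.
move=> pf ph; pose g (j : 'I_2) (t : 1.-tuple nat) :=
  if j == 0 :> nat then Some (nth 0 t 0) else unary h t.
have pg j : partial_computable (g j).
  by rewrite /g; case: eqP => // _; apply: computable_proj.
have := pc_comp pf pg; congr partial_computable; apply/funext => t.
rewrite /pcomposition /unary; case E: (otuple _) => [s|] /=.
  have gs j : g j t = Some (tnth s j).
    by have := congr1 (fun u : 2.-tuple _ => tnth u j) (otuple_inv E); rewrite tnth_mktuple tnth_map.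
  have := gs (@Ordinal 2 1 isT); rewrite (tnth_nth 0) /g /unary /= => ->.
  by have := gs (@Ordinal 2 0 isT); rewrite (tnth_nth 0) /g /= => -[->].
case Eh: (h _) => [y|] //=.
suff : [tuple g j t | j < 2] = [tuple of map some [tuple nth 0 t 0; y]].
  by move=> gE; rewrite gE otuple_some in E.
apply: eq_from_tnth => j; rewrite tnth_mktuple tnth_map (tnth_nth 0) /g /unary.
by case: j => -[|[]] //= _; rewrite Eh.
Qed.

Lemma pc_apply (F : nat -> nat -> nat -> nat) (c k : nat)
    (g : 'I_k -> nat -> option nat) :
  computable (ternary F) -> (forall j, partial_computable (unary (g j))) ->
  partial_computable (unary (fun i =>
    omap (fun s : k.-tuple nat => F i c (CodeSeq.code s))
         (otuple [tuple g j i | j < k]))).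
Proof.
move=> pF pg; have ph := pc_comp (computable_code k) pg.
pose h i := omap (fun s : k.-tuple nat => CodeSeq.code s)
  (otuple [tuple g j i | j < k]).
have {ph} /(pc_omap _) ph : partial_computable (unary h) by [].
have := ph (fun i y => F i c y); rewrite /h.
have pFc : computable (binary (fun i => [eta F i c])).
  pose G (j : 'I_3) (t : 2.-tuple nat) : nat :=
    if j == 0 :> nat then nth 0 t 0 else if j == 1 :> nat then c else nth 0 t 1.
  have := pc_comp_total (g := G) pF.
  rewrite /computable /ternary /binary => pFG.
  have {}pFG := pFG (fun j => _); move: pFG.
  under eq_fun do rewrite !nth_mktuple /=.
  apply=> j; rewrite /G; case: eqP => _; first exact: computable_proj.
  by case: eqP => _; [apply: computable_const | apply: computable_proj].
move=> /(_ pFc); congr partial_computable; congr unary; apply/funext => i.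
by case: otuple.
Qed.

Lemma computable_structure_const L (A : nat_structure L) :
  computable_structure A -> uniformly_computable (fun=> A).
Proof.
case=> pdom [F pF FE] [R pR RE]; split.
- apply: (computable_unary (f := fun a => `[< dom A a >] : nat) pdom).
  exact: computable_proj.
- exists (fun=> F) => //.
  by apply: (computable_binary pF); apply: computable_proj.
- exists (fun=> R) => //.
  apply: (computable_binary (f := fun x y => `[< R x y >] : nat) pR);
    exact: computable_proj.
Qed.

Lemma almost_subsetS (C X Y : set nat) :
  X `<=` Y -> almost_subset C X -> almost_subset C Y.
Proof. by move=> XY; apply: sub_finite_set => i [Ci nY]; split=> // /XY. Qed.

Lemma almost_subsetI (C X Y : set nat) :
  almost_subset C X -> almost_subset C Y -> almost_subset C (X `&` Y).
Proof. by rewrite /almost_subset setDIr finite_setU. Qed.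

Lemma almost_subset_forall (C : set nat) k (X : 'I_k -> set nat) :
  (forall j, almost_subset C (X j)) ->
  almost_subset C [set i | forall j, X j i].
Proof.
move=> CX; suff /almost_subsetS : almost_subset C
    [set i | forall j, j \in enum 'I_k -> X j i].
  by apply=> i Xi j; apply: Xi; rewrite mem_enum.
elim: (enum _) => [|j s ih].
  by rewrite /almost_subset [X in finite_set X](_ : _ = set0) //;
    apply/seteqP; split=> // i [_]; apply.
apply: almost_subsetS (almost_subsetI (CX j) ih) => i [Xj Xs] l.
by rewrite inE => /predU1P[->//|/Xs].
Qed.

Section CohesiveProduct.
Variables (L : language) (A : nat -> nat_structure L) (C : set nat).

(* The partial functions [i |-> phi i] in the domain of the product, before
   identification. *)
Record cohesive_fun := CohesiveFun {
  cval :> forall i, option (A i);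
  cval_pc : partial_computable (unary (fun i => omap (@value L (A i)) (cval i)));
  cval_dom : almost_subset C [set i | cval i] }.

HB.instance Definition _ := gen_eqMixin cohesive_fun.
HB.instance Definition _ := gen_choiceMixin cohesive_fun.

Definition cohesive_eq (phi psi : cohesive_fun) : bool :=
  `[< almost_subset C [set i | exists2 a, phi i = Some a & psi i = Some a] >].

Lemma cohesive_eq_refl : reflexive cohesive_eq.
Proof.
move=> phi; apply/asboolP; apply: almost_subsetS (cval_dom phi) => i /=.
by case: (phi i) => // a _; exists a.
Qed.

Lemma cohesive_eq_sym : symmetric cohesive_eq.
Proof.
suff h phi psi : cohesive_eq phi psi -> cohesive_eq psi phi.
  by move=> phi psi; apply/idP/idP; apply: h.
move=> /asboolP h; apply/asboolP; apply: almost_subsetS h => i [a ? ?].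
by exists a.
Qed.

Lemma cohesive_eq_trans : transitive cohesive_eq.
Proof.
move=> psi phi chi /asboolP h /asboolP h'; apply/asboolP.
apply: almost_subsetS (almost_subsetI h h') => i [[a pa qa] [b qb cb]].
by exists a => //; rewrite cb -qb qa.
Qed.

Canonical cohesive_equiv :=
  EquivRel cohesive_eq cohesive_eq_refl cohesive_eq_sym cohesive_eq_trans.

Definition cohesive_carrier := {eq_quot cohesive_equiv}.

Definition values_at k (phi : k.-tuple cohesive_fun) (i : nat) :
    option (k.-tuple (A i)) :=
  otuple [tuple tnth phi j i | j < k].

Lemma values_at_dom k (phi : k.-tuple cohesive_fun) :
  almost_subset C [set i | values_at phi i].
Proof.
apply: almost_subsetS (almost_subset_forall (fun j => cval_dom (tnth phi j))).
move=> i /= phii.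
have def j : exists a, tnth phi j i = Some a.
  by have := phii j; case: (tnth phi j i) => // a _; exists a.
pose a j := sval (cid (def j)).
rewrite /values_at (_ : [tuple _ | j < k] =
  [tuple of map some [tuple a j | j < k]]) ?otuple_some //.
apply: eq_from_tnth => j; rewrite tnth_map !tnth_mktuple.
exact: svalP (cid (def j)).
Qed.

Section Functions.
Hypothesis computableA : uniformly_computable A.
Variables (f : fsym L) (phi : (far f).-tuple cohesive_fun).

Definition apply_at (i : nat) : option (A i) :=
  omap (@fint L (A i) f) (values_at phi i).

Lemma apply_at_pc :
  partial_computable (unary (fun i => omap (@value L (A i)) (apply_at i))).
Proof.
have [_ [F pF FE] _] := computableA.
have := pc_apply (pickle f) pF (fun j => cval_pc (tnth phi j)).
congr partial_computable; congr unary; apply/funext => i.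
rewrite /apply_at /values_at (_ : [tuple _ | j < far f] = [tuple of
  map (omap (@value L (A i))) [tuple tnth phi j i | j < far f]]); last first.
  by apply: eq_from_tnth => j; rewrite tnth_map !tnth_mktuple.
by rewrite otuple_omap; case: otuple => //= s; rewrite -FE.
Qed.

Lemma apply_at_dom : almost_subset C [set i | apply_at i].
Proof.
apply: almost_subsetS (values_at_dom phi) => i /=.
by rewrite /apply_at; case: values_at.
Qed.

Definition cohesive_apply := CohesiveFun apply_at_pc apply_at_dom.

End Functions.

Definition cohesive_holds (r : rsym L) (phi : (rar r).-tuple cohesive_fun) :=
  almost_subset C
    [set i | exists2 a, values_at phi i = Some a & @rint L (A i) r a].

Definition cohesive_product (computableA : uniformly_computable A) :
    structure L :=
  @Structure L cohesive_carrier
    (fun f x => \pi_cohesive_carrier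
       (cohesive_apply computableA [tuple of map repr x]))
    (fun r x => cohesive_holds [tuple of map repr x]).

(* The choice of representatives in the operations above is immaterial. *)
Lemma values_at_repr k (phi : k.-tuple cohesive_fun) :
  almost_subset C [set i | exists2 a, values_at phi i = Some a &
    values_at [tuple of map (repr \o \pi_cohesive_carrier) phi] i = Some a].
Proof.
have h j : almost_subset C [set i | exists2 a, tnth phi j i = Some a &
    repr (\pi_cohesive_carrier (tnth phi j)) i = Some a].
  apply/asboolP; rewrite -/(cohesive_eq _ _).
  by have /eqmodP := esym (reprK (\pi_cohesive_carrier (tnth phi j))).
apply: almost_subsetS (almost_subsetI (values_at_dom phi)
  (almost_subset_forall h)) => i [/= + hi].
case E: (values_at phi i) => [a|] // _; exists a => //; rewrite -E.
congr otuple; apply: eq_from_tnth => j; rewrite !tnth_mktuple tnth_map.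
by have [b -> ->] := hi j.
Qed.

Lemma cohesive_fintE (computableA : uniformly_computable A) (f : fsym L)
    (phi : (far f).-tuple cohesive_fun) :
  @fint L (cohesive_product computableA) f
    [tuple of map \pi_cohesive_carrier phi] =
  \pi_cohesive_carrier (cohesive_apply computableA phi).
Proof.
apply/eqmodP/asboolP; apply: almost_subsetS (values_at_repr phi) => i /=.
rewrite /apply_at => -[a -> h]; exists (@fint L (A i) f a) => //.
by rewrite (_ : [tuple of _] = [tuple of map (repr \o \pi_cohesive_carrier) phi])
  ?h //; apply: val_inj => /=; rewrite map_comp.
Qed.

Lemma cohesive_rintE (computableA : uniformly_computable A) (r : rsym L)
    (phi : (rar r).-tuple cohesive_fun) :
  @rint L (cohesive_product computableA) r
    [tuple of map \pi_cohesive_carrier phi] <->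
  cohesive_holds phi.
Proof.
have E : [tuple of map repr [tuple of map \pi_cohesive_carrier phi]] =
    [tuple of map (repr \o \pi_cohesive_carrier) phi].
  by apply: val_inj => /=; rewrite map_comp.
have hphi := values_at_repr phi; rewrite /= E; split=> h;
  apply: almost_subsetS (almost_subsetI hphi h) => i [[a pa qa] [b]].
- by rewrite qa => -[<-]; exists a.
- by rewrite pa => -[<-]; exists a.
Qed.

Definition uniformly_partial_computable (e : nat -> cohesive_carrier) :=
  exists2 psi : nat -> cohesive_fun,
    forall l, e l = \pi_cohesive_carrier (psi l) &
    partial_computable (binary (fun l i => omap (@value L (A i)) (psi l i))).

End CohesiveProduct.

Definition cohesive_power L (A : nat_structure L) (C : set nat)
    (computableA : computable_structure A) : structure L :=
  cohesive_product C (computable_structure_const computableA).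

(* Main.v *)
Require Import Defs.
From mathcomp Require Import all_boot.
From mathcomp Require Import boolp classical_sets functions cardinality.

Set Implicit Arguments.
Unset Strict Implicit.
Unset Printing Implicit Defensive.

Local Open Scope classical_set_scope.

                                                                                 
                                                                              
                                                                           
                                                                                
                    

                                                                           
                                                                             
                                                                               
                                                                             
                                                                                  
                                                                                  
                                                                                 
                                                                            
          

                                                    

(** The difficulty is to turn finite satisfiability into one computable choice. Since $\Sigma_n$
    truth in $\mathcal{A}_i$ is decidable uniformly in $i$, a $\Sigma_{n+1}$ formula is
    semidecidable there: one searches for witnesses of its leading existential block and decides the
    remaining $\Pi_n$ formula through its dual ([sigma_checkP]). Hence the set of $i$ at which such
    a formula holds of given elements of the product is c.e. up to finitely many elements of $C$,
    and cohesiveness makes it contain or miss almost all of $C$ ([semidecidable_decided]). This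
    yields a Łoś theorem for $\Sigma_{n+1}$ formulas ([los]): truth in the product is truth at
    almost every $i \in C$. For an existential quantifier, the search for a witness is itself a
    partial computable function defined on almost all of $C$. A universal quantifier outermost in
    the formula under consideration makes that formula $\Pi_n$; were it to fail at almost every $i
    \in C$, a search for counterexamples would produce an element refuting it in the product.

    Let $p$ be a computable $\Sigma_{n+1}$-type and let $U(s,i,w)$ say that $w$ codes a tuple of
    $\mathcal{A}_i$ with evidence that it satisfies every formula of $p$ with code below $s$. Then
    $U$ is decidable and decreasing in $s$, and finite satisfiability with [los] gives, for each
    $s$, some $w$ at almost every $i \in C$ ([almost_satisfied]). What is needed is one partial
    computable $v$ such that, for every $s$, $U(s,i,v(i))$ holds at almost every $i \in C$; its
    coordinates then realize $p$, again by [los].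

    The existence of $v$ is [uniformization], where $C$ being $\Delta_2$ enters through computable
    guesses converging to $C$ ([Delta2_limit]). Requirement $s$ wants some $i \ge s$ in $C$ that
    carries a value $w$ with $U(s,i,w)$. Values are assigned once and never withdrawn, and a
    proposal for $s$ at $i$ is turned down when a place between $s$ and $i$ that is guessed to be in
    $C$ already serves $s$. Once the guesses have settled up to a suitable $i \in C$, requirement
    $s$ is served for good and claims nothing beyond $i$, which leaves room for the requirements
    after it. Values assigned for larger requirements serve $s$ too, as $U$ is decreasing. So the
    c.e. set of $i$ with $U(s,i,v(i))$ meets $C$ infinitely often, and by cohesiveness it contains
    almost all of $C$. *)

(** * Primitive recursive decoding of sequence codes *)

Section Primitive.

Let proj := computable_proj.

Lemma computable_ternary k (f : nat -> nat -> nat -> nat)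
    (a b c : k.-tuple nat -> nat) :
  computable (ternary f) -> computable a -> computable b -> computable c ->
  computable (fun t => f (a t) (b t) (c t)).
Proof.
move=> pf pa pb pc.
pose g (j : 'I_3) := if j == 0 :> nat then a else if j == 1 :> nat then b else c.
have pg j : computable (g j) by rewrite /g; case: ifP => // _; case: ifP.
have := pc_comp_total pf pg; congr partial_computable; apply/funext => t.
by rewrite /ternary !Defs.nth_mktuple.
Qed.

Lemma computable_even : computable (unary (fun n => ~~ odd n : nat)).
Proof.
have pnot : computable (unary (fun n => (n == 0) : nat)).
  by apply: (computable_primrec1 (c := 1) (g := fun _ _ => 0)) => //;
    apply: computable_const.
apply: (computable_primrec1 (c := 1) (g := fun _ y => (y == 0) : nat)) => //.
  by apply: computable_unary pnot _; apply: proj.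
by move=> n /=; case: (odd n).
Qed.

Lemma computable_half : computable (unary half).
Proof.
have podd : computable (unary (fun n => odd n : nat)).
  apply: (computable_primrec1 (c := 0) (g := fun n _ => ~~ odd n : nat)) => //.
  by apply: computable_unary computable_even _; apply: proj.
apply: (computable_primrec1 (c := 0) (g := fun n y => odd n + y)) => //.
  apply: (computable_binary computable_addn); last exact: proj.
  by apply: (computable_unary podd); apply: proj.
by move=> n; rewrite -uphalf_half.
Qed.

(** The code of [n :: s] is $2^n$ times an odd number, so its head is the exponent of 2. The bound
    [v] on the number of halvings makes this a primitive recursion. *)
Fixpoint twos (v x : nat) : nat :=
  if v is v'.+1 then twos v' x + ~~ odd (iter (twos v' x) half x) else 0.

Definition code_head (x : nat) := twos x x.
Definition code_tail (x : nat) := (iter (code_head x) half x)./2.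

Lemma computable_iter_half : computable (binary (fun v x => iter v half x)).
Proof.
apply: (computable_primrec2 (b := id) (g := fun _ y _ => y./2)) => //.
  exact: (@proj 1 0).
by apply: computable_unary computable_half _; apply: proj.
Qed.

Lemma computable_code_head : computable (unary code_head).
Proof.
suff ptwos : computable (binary twos).
  by apply: (computable_binary ptwos); apply: proj.
apply: (computable_primrec2 (b := fun=> 0)
  (g := fun _ y x => y + ~~ odd (iter y half x))) => //.
  exact: computable_const.
apply: (computable_binary computable_addn); first exact: proj.
apply: (computable_unary computable_even).
by apply: (computable_binary computable_iter_half); apply: proj.
Qed.

Lemma computable_code_tail : computable (unary code_tail).
Proof.
apply: (computable_unary computable_half).
apply: (computable_binary computable_iter_half); last exact: proj.
by apply: (computable_unary computable_code_head); apply: proj.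
Qed.

Lemma iter_half_exp n y : iter n half (2 ^ n * y) = y.
Proof.
elim: n => [|n ih]; first by rewrite mul1n.
by rewrite iterSr expnS -mulnA mul2n doubleK.
Qed.

Lemma code_headE n s : code_head (CodeSeq.code (n :: s)) = n.
Proof.
rewrite /= /code_head; set y := (CodeSeq.code s).*2.+1.
have h v : twos v (2 ^ n * y) = minn v n.
  elim: v => [|v ih] /=; first by rewrite min0n.
  rewrite ih; case: (ltnP v n) => [vn|nv].
    rewrite -(subnKC vn) expnD expnSr -!mulnA iter_half_exp oddM addn1.
    by apply/esym/minn_idPl; rewrite leq_addr.
  by rewrite iter_half_exp /= odd_double addn0; apply/esym/minn_idPr/ltnW.
(* The code itself is a sufficient bound, because $n < 2^n$. *)
rewrite h; apply/minn_idPr; rewrite (leq_trans (ltnW (ltn_expl n (ltnSn 1)))) //.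
by rewrite leq_pmulr.
Qed.

Lemma code_tailE n s : code_tail (CodeSeq.code (n :: s)) = CodeSeq.code s.
Proof. by rewrite /code_tail code_headE /= iter_half_exp /= uphalf_double. Qed.

End Primitive.

Arguments code_head : simpl never.
Arguments code_tail : simpl never.

                                                                           
                                                                         
              
(** * Effective maps between countable types *)

(** The function [F] is constrained only on codes. On [nat] the code is the number itself, so
    effectiveness is computability there; pairs and sequences are coded by [CodeSeq.code] of the
    codes of their entries. Computability proofs can thus follow the syntax of [f]. *)
Definition effective (T U : countType) (f : T -> U) :=
  exists2 F : nat -> nat, computable (unary F) &
    forall x, F (pickle x) = pickle (f x).

Section Effective.
Implicit Types T U V : countType.

Lemma eff_id T : effective (fun x : T => x).
Proof. by exists id => //; apply: (@computable_proj 1 0). Qed.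

Lemma eff_const T U (c : U) : effective (fun _ : T => c).
Proof. by exists (fun=> pickle c) => //; apply: computable_const. Qed.

Lemma eff_app T U V (f : U -> V) (g : T -> U) :
  effective f -> effective g -> effective (fun x => f (g x)).
Proof.
move=> [F pF FE] [G pG GE]; exists (F \o G).
  exact: computable_unary pF pG.
by move=> x /=; rewrite GE FE.
Qed.

Lemma eff_unary T (f : nat -> nat) (g : T -> nat) :
  computable (unary f) -> effective g -> effective (fun x => f (g x)).
Proof. by move=> pf; apply: eff_app; exists f. Qed.

Lemma eff_binary T (f : nat -> nat -> nat) (g h : T -> nat) :
  computable (binary f) -> effective g -> effective h ->
  effective (fun x => f (g x) (h x)).
Proof.
move=> pf [G pG GE] [H pH HE]; exists (fun x => f (G x) (H x)).
  exact: computable_binary pf pG pH.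
by move=> x; rewrite GE HE.
Qed.

Lemma eff_ternary T (f : nat -> nat -> nat -> nat) (g h k : T -> nat) :
  computable (ternary f) -> effective g -> effective h -> effective k ->
  effective (fun x => f (g x) (h x) (k x)).
Proof.
move=> pf [G pG GE] [H pH HE] [K pK KE]; exists (fun x => f (G x) (H x) (K x)).
  exact: computable_ternary pf pG pH pK.
by move=> x; rewrite GE HE KE.
Qed.

Lemma eff_pickle T U (f : T -> U) :
  effective f -> effective (fun x => pickle (f x)).
Proof. by []. Qed.

Lemma eff_of_pickle T U (f : T -> U) :
  effective (fun x => pickle (f x)) -> effective f.
Proof. by []. Qed.

Lemma eff_nat_of_bool T (c : T -> bool) :
  effective c -> effective (fun x => c x : nat).
Proof. by []. Qed.

Lemma computable_of_eff (f : nat -> nat) : effective f -> computable (unary f).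
Proof.
case=> F pF FE; suff -> : f = F by [].
by apply/funext => x; apply/esym/FE.
Qed.

Lemma eff_succn T (f : T -> nat) : effective f -> effective (fun x => (f x).+1).
Proof. exact: eff_unary computable_succn. Qed.

Lemma eff_code_cons T (f g : T -> nat) : effective f -> effective g ->
  effective (fun x => 2 ^ f x * (g x).*2.+1).
Proof. exact: eff_binary computable_code_cons. Qed.

Lemma eff_cons T U (f : T -> U) (g : T -> seq U) :
  effective f -> effective g -> effective (fun x => f x :: g x).
Proof. by move=> /eff_pickle pf /eff_pickle pg; apply/eff_of_pickle/eff_code_cons. Qed.

Lemma eff_pair T U V (f : T -> U) (g : T -> V) :
  effective f -> effective g -> effective (fun x => (f x, g x)).
Proof.
move=> /eff_pickle pf /eff_pickle pg; apply/eff_of_pickle.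
by apply: eff_code_cons => //; apply: eff_code_cons => //; apply: eff_const.
Qed.

Lemma eff_fst T U V (f : T -> U * V) : effective f -> effective (fun x => (f x).1).
Proof.
apply: (@eff_app T (U * V)%type _ fst); exists code_head.
  exact: computable_code_head.
by move=> x; apply: code_headE.
Qed.

Lemma eff_snd T U V (f : T -> U * V) : effective f -> effective (fun x => (f x).2).
Proof.
apply: (@eff_app T (U * V)%type _ snd); exists (code_head \o code_tail).
  exact: computable_unary computable_code_head computable_code_tail.
move=> x /=; rewrite -[pickle x]/(CodeSeq.code [:: pickle x.1; pickle x.2]).
by rewrite code_tailE code_headE.
Qed.

(** Primitive recursion is run on codes, with the code of [x] carried along as the parameter. Case
    distinctions, folds and the other list operations below come down to this one scheme. *)
Lemma eff_nat_rect T U (n : T -> nat) (b : T -> U) (g : T -> nat -> U -> U) :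
  effective n -> effective b ->
  effective (fun p : T * (nat * U) => g p.1 p.2.1 p.2.2) ->
  effective (fun x => nat_rect (fun=> U) (b x) (g x) (n x)).
Proof.
move=> [N pN NE] [B pB BE] [G pG GE].
pose G' n y c := G (CodeSeq.code [:: c; CodeSeq.code [:: n; y]]).
pose H n c := nat_rect (fun=> nat) (B c) (fun n y => G' n y c) n.
have pG' : computable (ternary G').
  have := computable_code_cons; rewrite -/(computable _) => pcons.
  have pnil k := @computable_const k 0.
  apply: (computable_unary pG); apply: (computable_binary pcons).
    exact: computable_proj.
  apply: (computable_binary pcons) (pnil 3).
  apply: (computable_binary pcons); first exact: computable_proj.
  by apply: (computable_binary pcons) (pnil 3); apply: computable_proj.
have pH : computable (binary H) by apply: computable_primrec2 pB pG' _ _.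
exists (fun c => H (N c) c).
  by apply: (computable_binary pH) pN _; apply: computable_proj.
move=> x; rewrite NE -[pickle (n x)]/(n x).
elim: (n x) => [|m ih] /=; first exact: BE.
by rewrite -/(H m (pickle x)) ih /G' -(GE (x, (m, _))).
Qed.

Lemma eff_case_nat T U (n : T -> nat) (b : T -> U) (g : T -> nat -> U) :
  effective n -> effective b -> effective (fun p : T * nat => g p.1 p.2) ->
  effective (fun x => if n x is m.+1 then g x m else b x).
Proof.
move=> pn pb pg.
rewrite (_ : (fun x => _) = fun x =>
  nat_rect (fun=> U) (b x) (fun m _ => g x m) (n x)); last first.
  by apply/funext => x; case: (n x).
apply: eff_nat_rect => //.
apply: (eff_app pg (g := fun p : T * (nat * U) => (p.1, p.2.1))).
by apply: eff_pair; [apply/eff_fst/eff_id | apply/eff_fst/eff_snd/eff_id].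
Qed.

Lemma eff_if T U (c : T -> bool) (a b : T -> U) :
  effective c -> effective a -> effective b ->
  effective (fun x => if c x then a x else b x).
Proof.
move=> /eff_pickle pc pa pb.
rewrite (_ : (fun x => _) = fun x => if pickle (c x) is m.+1 then a x else b x).
  by apply: eff_case_nat => //; apply: (eff_app pa); apply/eff_fst/eff_id.
by apply/funext => x; case: (c x).
Qed.

Lemma eff_negb T (c : T -> bool) : effective c -> effective (fun x => ~~ c x).
Proof. by move=> pc; apply: eff_if => //; apply: eff_const. Qed.

Lemma eff_andb T (c d : T -> bool) :
  effective c -> effective d -> effective (fun x => c x && d x).
Proof. by move=> pc pd; apply: eff_if => //; apply: eff_const. Qed.

Lemma eff_orb T (c d : T -> bool) :
  effective c -> effective d -> effective (fun x => c x || d x).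
Proof. by move=> pc pd; apply: eff_if => //; apply: eff_const. Qed.

Lemma eff_predn T (f : T -> nat) : effective f -> effective (fun x => (f x).-1).
Proof.
move=> pf; apply: eff_case_nat => //; last exact/eff_snd/eff_id.
Qed.

Lemma eff_addn T (f g : T -> nat) :
  effective f -> effective g -> effective (fun x => f x + g x).
Proof. exact: eff_binary computable_addn. Qed.

Lemma eff_subn T (f g : T -> nat) :
  effective f -> effective g -> effective (fun x => f x - g x).
Proof.
move=> pf pg.
rewrite (_ : (fun x => _) = fun x =>
  nat_rect (fun=> nat) (f x) (fun _ y => y.-1) (g x)); last first.
  apply/funext => x; elim: (g x) => [|m /= <-]; first exact: subn0.
  by rewrite subnS.
by apply: eff_nat_rect => //; apply/eff_predn/eff_snd/eff_snd/eff_id.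
Qed.

Lemma eff_leq T (f g : T -> nat) :
  effective f -> effective g -> effective (fun x => f x <= g x).
Proof.
move=> pf pg.
rewrite (_ : (fun x => _) = fun x => if f x - g x is _.+1 then false else true).
  by apply: eff_case_nat; [apply: eff_subn | apply: eff_const..].
by apply/funext => x; rewrite /leq; case: (f x - g x).
Qed.

Lemma eff_eq T U (f g : T -> U) :
  effective f -> effective g -> effective (fun x => f x == g x).
Proof.
move=> /eff_pickle pf /eff_pickle pg.
rewrite (_ : (fun x => _) = fun x => (pickle (f x) <= pickle (g x)) &&
    (pickle (g x) <= pickle (f x))).
  by apply: eff_andb; apply: eff_leq.
apply/funext => x; rewrite -eqn_leq; apply/eqP/eqP => [->//|].
exact: (pcan_inj pickleK).
Qed.

(** Only the empty sequence has code 0, so the distinction is one on a number. *)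
Lemma eff_case_seq T U V (l : T -> seq U) (b : T -> V) (g : T -> U -> seq U -> V) :
  effective l -> effective b ->
  effective (fun p : T * (U * seq U) => g p.1 p.2.1 p.2.2) ->
  effective (fun x => if l x is a :: s then g x a s else b x).
Proof.
move=> [L pL LE] pb [G pG GE].
pose G' x := let c := L x in
  G (CodeSeq.code [:: x; CodeSeq.code [:: code_head c; code_tail c]]).
have [B pB BE] := pb.
have pcons := computable_code_cons.
have pnil k := @computable_const k 0.
have pG' : computable (unary G').
  apply: (computable_unary pG); apply: (computable_binary pcons).
    exact: computable_proj.
  apply: (computable_binary pcons) (pnil 1).
  apply: (computable_binary pcons).
    exact: computable_unary computable_code_head pL.
  apply: (computable_binary pcons) (pnil 1).
  exact: computable_unary computable_code_tail pL.
exists (fun x => if L x is _.+1 then G' x else B x).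
  apply: computable_of_eff; apply: eff_case_nat.
  - by apply: (eff_unary pL); apply: eff_id.
  - by apply: (eff_unary pB); apply: eff_id.
  - by apply: (eff_unary pG'); apply/eff_fst/eff_id.
move=> x; rewrite /G' LE.
case: (l x) => [|a s]; first exact: BE.
rewrite -[pickle (a :: s)]/(CodeSeq.code (pickle a :: map pickle s)).
rewrite code_headE code_tailE; case E : (CodeSeq.code _) => [|m].
  by move/eqP: E; rewrite /= muln_eq0 expn_eq0.
exact: (GE (x, (a, s))).
Qed.

End Effective.

                                                                         
Ltac eff_step := match goal with
  | |- effective (fun x => x) => exact: eff_id
  | |- effective (fun _ => ?c) => exact: eff_const
  | |- effective (fun x => (@?a x, @?b x)) => apply: (@eff_pair _ _ _ a b)
  | |- effective (fun x => (@?a x).1) => apply: (@eff_fst _ _ _ a)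
  | |- effective (fun x => (@?a x).2) => apply: (@eff_snd _ _ _ a)
  | |- effective fst => exact/eff_fst/eff_id
  | |- effective snd => exact/eff_snd/eff_id
  | |- effective (fun x => pickle (@?a x)) => apply: (@eff_pickle _ _ a)
  | |- effective (fun x => nat_of_bool (@?a x)) => apply: (@eff_nat_of_bool _ a)
  | |- effective (fun x => S (@?a x)) => apply: (@eff_succn _ a)
  | |- effective (fun x => @?a x + @?b x) => apply: (@eff_addn _ a b)
  | |- effective (fun x => @?a x - @?b x) => apply: (@eff_subn _ a b)
  | |- effective (fun x => @?a x <= @?b x) => apply: (@eff_leq _ a b)
  | |- effective (fun x => @?a x == @?b x) => apply: (@eff_eq _ _ a b)
  | |- effective (fun x => ~~ @?a x) => apply: (@eff_negb _ a)
  | |- effective (fun x => @?a x && @?b x) => apply: (@eff_andb _ a b)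
  | |- effective (fun x => @?a x || @?b x) => apply: (@eff_orb _ a b)
  | |- effective (fun x => cons (@?a x) (@?b x)) => apply: (@eff_cons _ _ a b)
  | _ => assumption
  end.
Ltac eff := repeat eff_step.

Section EffectiveSeq.
Implicit Types T U V : countType.

Lemma code_ge_size s : size s <= CodeSeq.code s.
Proof.
elim: s => //= n s ih; apply: (@leq_trans (CodeSeq.code s).+1) => //.
by rewrite (leq_trans _ (leq_pmull _ _)) ?expn_gt0 // ltnS -addnn leq_addr.
Qed.

Lemma eff_foldl T U V (h : T -> V -> U -> V) (z : T -> V) (l : T -> seq U) :
  effective (fun p : T * (V * U) => h p.1 p.2.1 p.2.2) ->
  effective z -> effective l ->
  effective (fun x => foldl (h x) (z x) (l x)).
Proof.
move=> ph pz pl.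
pose step x (p : seq U * V) :=
  if p.1 is u :: s then (s, h x p.2 u) else p.
pose it x := nat_rect (fun=> (seq U * V)%type) (l x, z x)
  (fun _ p => step x p).
rewrite (_ : (fun x => _) = fun x => (it x (pickle (l x))).2); last first.
  apply/funext => x.
  have sz : size (l x) <= pickle (l x).
    by rewrite (leq_trans _ (code_ge_size _)) ?size_map.
  have h0 n v : nat_rect (fun=> (seq U * V)%type) ([::], v)
      (fun _ p => step x p) n = ([::], v) by elim: n => //= n ->.
  have hS n p : nat_rect (fun=> (seq U * V)%type) p (fun _ p => step x p) n.+1 =
      nat_rect (fun=> (seq U * V)%type) (step x p) (fun _ p => step x p) n.
    by elim: n => //= n ->.
  rewrite /it; move: (pickle (l x)) sz => n.
  elim: (l x) (z x) n => [|u s ih] v n sz; first by rewrite h0.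
  by case: n sz => // n sz; rewrite hS; apply: ih.
apply: eff_snd; apply: eff_nat_rect; [by eff | by eff |].
apply: eff_case_seq; [by eff | by eff |].
apply: eff_pair; first by eff.
by apply: (eff_app ph (g := fun p : (T * (nat * (seq U * V))) * (U * seq U) =>
  (p.1.1, (p.1.2.2.2, p.2.1)))); eff.
Qed.

Lemma eff_rev T U (l : T -> seq U) : effective l -> effective (fun x => rev (l x)).
Proof.
move=> pl; rewrite (_ : (fun x => _) =
  fun x => foldl (fun s a => a :: s) [::] (l x)).
  by apply: eff_foldl; eff.
apply/funext => x; rewrite /rev.
by elim: (l x) [::] => //= a s ih z; rewrite ih.
Qed.

Lemma eff_foldr T U V (h : T -> U -> V -> V) (z : T -> V) (l : T -> seq U) :
  effective (fun p : T * (U * V) => h p.1 p.2.1 p.2.2) ->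
  effective z -> effective l ->
  effective (fun x => foldr (h x) (z x) (l x)).
Proof.
move=> ph pz pl; rewrite (_ : (fun x => _) =
  fun x => foldl (fun v u => h x u v) (z x) (rev (l x))); last first.
  by apply/funext => x; rewrite foldl_rev.
apply: eff_foldl => //; last exact: eff_rev.
by apply: (eff_app ph (g := fun p : T * (V * U) => (p.1, (p.2.2, p.2.1)))); eff.
Qed.

Lemma eff_map T U V (h : T -> U -> V) (l : T -> seq U) :
  effective (fun p : T * U => h p.1 p.2) -> effective l ->
  effective (fun x => map (h x) (l x)).
Proof.
move=> ph pl.
apply: (eff_foldr (h := fun x u s => h x u :: s) (z := fun=> [::])) => //.
  apply: eff_cons; last by eff.
  by apply: (eff_app ph (g := fun p : T * (U * seq V) => (p.1, p.2.1))); eff.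
by eff.
Qed.

Lemma eff_filter T U (h : T -> U -> bool) (l : T -> seq U) :
  effective (fun p : T * U => h p.1 p.2) -> effective l ->
  effective (fun x => filter (h x) (l x)).
Proof.
move=> ph pl.
apply: (eff_foldr (h := fun x u s => if h x u then u :: s else s)
  (z := fun=> [::])) => //; last by eff.
apply: eff_if; [|by eff..].
by apply: (eff_app ph (g := fun p : T * (U * seq U) => (p.1, p.2.1))); eff.
Qed.

Lemma eff_all T U (h : T -> U -> bool) (l : T -> seq U) :
  effective (fun p : T * U => h p.1 p.2) -> effective l ->
  effective (fun x => all (h x) (l x)).
Proof.
move=> ph pl.
apply: (eff_foldr (h := fun x u b => h x u && b) (z := fun=> true)) => //.
  apply: eff_andb; last by eff.
  by apply: (eff_app ph (g := fun p : T * (U * bool) => (p.1, p.2.1))); eff.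
by eff.
Qed.

Lemma eff_has T U (h : T -> U -> bool) (l : T -> seq U) :
  effective (fun p : T * U => h p.1 p.2) -> effective l ->
  effective (fun x => has (h x) (l x)).
Proof.
move=> ph pl; rewrite (_ : (fun x => _) = fun x => ~~ all (fun u => ~~ h x u) (l x)).
  by apply: eff_negb; apply: eff_all => //; apply: eff_negb.
by apply/funext => x; rewrite -has_predC; apply: eq_has => u /=; rewrite negbK.
Qed.

Lemma eff_size T U (l : T -> seq U) : effective l -> effective (fun x => size (l x)).
Proof.
move=> pl; apply: (eff_foldr (h := fun=> fun=> S) (z := fun=> 0)) => //; eff.
Qed.

Lemma eff_cat T U (k l : T -> seq U) :
  effective k -> effective l -> effective (fun x => k x ++ l x).
Proof.
move=> pk pl; rewrite (_ : (fun x => _) = fun x => foldr cons (l x) (k x)).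
  by apply: (eff_foldr (h := fun=> cons)); eff.
by apply/funext => x; elim: (k x) => //= a s ->.
Qed.

Lemma eff_rcons T U (l : T -> seq U) (a : T -> U) :
  effective l -> effective a -> effective (fun x => rcons (l x) (a x)).
Proof.
move=> pl pa; under eq_fun do rewrite -cats1.
by apply: eff_cat; eff.
Qed.

Lemma eff_behead T U (l : T -> seq U) :
  effective l -> effective (fun x => behead (l x)).
Proof.
by move=> pl; apply: (eff_case_seq (b := fun=> [::]) (g := fun _ _ s => s)); eff.
Qed.

Lemma eff_nth T U (d : U) (l : T -> seq U) (n : T -> nat) :
  effective l -> effective n -> effective (fun x => nth d (l x) (n x)).
Proof.
move=> pl pn; rewrite (_ : (fun x => _) = fun x =>
  if nat_rect (fun=> seq U) (l x) (fun _ s => behead s) (n x) is a :: _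
  then a else d).
  apply: (eff_case_seq (g := fun _ a _ => a)); [|by eff..].
  by apply: eff_nat_rect => //; apply: eff_behead; eff.
apply/funext => x.
have -> : nat_rect (fun=> seq U) (l x) (fun _ s => behead s) (n x) =
    drop (n x) (l x).
  elim: (n x) => [|m /= ->]; first by rewrite drop0.
  by rewrite -drop1 drop_drop add1n.
by rewrite -[n x in LHS]addn0 -nth_drop; case: (drop _ _).
Qed.

Lemma eff_iota T (n : T -> nat) : effective n -> effective (fun x => iota 0 (n x)).
Proof.
move=> pn; rewrite (_ : (fun x => _) = fun x =>
  nat_rect (fun=> seq nat) [::] (fun m s => rcons s m) (n x)).
  by apply: eff_nat_rect => //; [eff | apply: eff_rcons; eff].
apply/funext => x; elim: (n x) => // m ih.
by rewrite [RHS]/= -ih -addn1 iotaD cats1.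
Qed.

Lemma eff_code T (l : T -> seq nat) :
  effective l -> effective (fun x => CodeSeq.code (l x)).
Proof.
move=> /eff_pickle; congr effective; apply/funext => x.
by rewrite -[pickle _]/(CodeSeq.code (map id _)) map_id.
Qed.

Lemma eff_decode T (n : T -> nat) :
  effective n -> effective (fun x => CodeSeq.decode (n x)).
Proof.
move=> pn; apply: eff_of_pickle; move: pn; congr effective.
by apply/funext => x; rewrite -[pickle _]/(CodeSeq.code (map id _)) map_id CodeSeq.decodeK.
Qed.

End EffectiveSeq.

Ltac eff_seq_step := match goal with
  | |- effective (fun x => nth ?d (@?l x) (@?n x)) => apply: (@eff_nth _ _ d l n)
  | |- effective (fun x => behead (@?l x)) => apply: (@eff_behead _ _ l)
  | |- effective (fun x => size (@?l x)) => apply: (@eff_size _ _ l)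
  | |- effective (fun x => @?k x ++ @?l x) => apply: (@eff_cat _ _ k l)
  | |- effective (fun x => iota 0 (@?n x)) => apply: (@eff_iota _ n)
  | |- effective (fun x => CodeSeq.code (@?l x)) => apply: (@eff_code _ l)
  | |- effective (fun x => CodeSeq.decode (@?n x)) => apply: (@eff_decode _ n)
  end.
Ltac eff ::= repeat first [eff_step | eff_seq_step].

Section EffectiveApplication.
Variables T U V W X : countType.

Lemma eff_app2 (f : U -> V -> W) (g : T -> U) (h : T -> V) :
  effective (fun p : U * V => f p.1 p.2) -> effective g -> effective h ->
  effective (fun x => f (g x) (h x)).
Proof. by move=> pf pg ph; apply: (eff_app pf (g := fun x => (g x, h x))); eff. Qed.

Lemma eff_app3 (f : U -> V -> W -> X) (g : T -> U) (h : T -> V) (k : T -> W) :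
  effective (fun p : U * (V * W) => f p.1 p.2.1 p.2.2) ->
  effective g -> effective h -> effective k ->
  effective (fun x => f (g x) (h x) (k x)).
Proof.
move=> pf pg ph pk.
by apply: (eff_app pf (g := fun x => (g x, (h x, k x)))); eff.
Qed.

End EffectiveApplication.

                                                                                
                                         
(** * Course-of-values recursion *)

(** The step function receives the list of all earlier values. Recursion on subterms and subformulas
    has this form, since their codes are smaller than the code of the whole. *)
Definition cov_hist T U (g : T -> nat -> seq U -> U) c n :=
  nat_rect (fun=> seq U) [::] (fun m s => rcons s (g c m s)) n.
Definition cov T U (g : T -> nat -> seq U -> U) c n := g c n (cov_hist g c n).

Lemma covE T U (g : T -> nat -> seq U -> U) c n :
  cov g c n = g c n (mkseq (cov g c) n).
Proof.
congr g; elim: n => // n ih; rewrite mkseqS -ih.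
by rewrite /cov_hist /=.
Qed.

Lemma eff_cov (T V U : countType) (g : T -> nat -> seq U -> U) (c : V -> T) (n : V -> nat) :
  effective (fun p : T * (nat * seq U) => g p.1 p.2.1 p.2.2) ->
  effective c -> effective n -> effective (fun x => cov g (c x) (n x)).
Proof.
move=> pg pc pn.
suff ph : effective (fun x => cov_hist g (c x) (n x)).
  by apply: (eff_app pg (g := fun x => (c x, (n x, cov_hist g (c x) (n x))))); eff.
apply: eff_nat_rect => //; first by eff.
apply: eff_rcons; first by eff.
by apply: (eff_app pg (g := fun p : V * (nat * seq U) =>
  (c p.1, (p.2.1, p.2.2)))); eff; apply: (eff_app pc); eff.
Qed.

Lemma eff_find (T U : countType) (h : T -> U -> bool) (l : T -> seq U) :
  effective (fun p : T * U => h p.1 p.2) -> effective l ->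
  effective (fun x => find (h x) (l x)).
Proof.
move=> ph pl.
apply: (eff_foldr (h := fun x u n => if h x u then 0 else n.+1)
  (z := fun=> 0)) => //; last by eff.
apply: eff_if; [|by eff..].
by apply: (eff_app ph (g := fun p : T * (U * nat) => (p.1, p.2.1))); eff.
Qed.

Lemma computable_of_eff_seq k (f : seq nat -> nat) :
  effective f -> computable (fun t : k.-tuple nat => f t).
Proof.
case=> F pF FE; have := computable_unary pF (@computable_code k).
congr partial_computable; apply/funext => t; congr Some.
have := FE t; rewrite -[pickle (tval t)]/(CodeSeq.code (map id _)) map_id.
exact.
Qed.

Lemma computable_binary_of_eff (f : nat -> nat -> nat) :
  effective (fun p : nat * nat => f p.1 p.2) -> computable (binary f).
Proof.
move=> pf; apply: (@computable_of_eff_seq 2 (fun l => f (nth 0 l 0) (nth 0 l 1))).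
by apply: (eff_app pf (g := fun l : seq nat => (nth 0 l 0, nth 0 l 1)));
  eff.
Qed.

                                                             

(** * Stagewise approximation of partial computable functions *)

Section Approximation.

                                                                              
                           
(** The value 0 means that no result has appeared by stage [s], and [y.+1] that the result is [y].
    Results persist, so finitely many computations can be awaited by taking a maximum of stages. *)
Definition approximates k (F : nat -> seq nat -> nat) (f : pfun k) :=
  [/\ effective (fun p : nat * seq nat => F p.1 p.2),
      forall s s' l y, s <= s' -> F s l = y.+1 -> F s' l = y.+1 &
      forall t y, f t = Some y <-> exists s, F s t = y.+1].

Lemma approximates_total k (f : seq nat -> nat) :
  effective f -> approximates (fun=> fun l => (f l).+1) (fun t : k.-tuple nat => Some (f t)).
Proof.
move=> pf; split=> //; first by apply: eff_succn; apply: (eff_app pf); eff.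
move=> t y; split=> [[<-]|[_ [->]]] //; by exists 0.
Qed.

Lemma otuple_tnthP T k (t : k.-tuple (option T)) (s : k.-tuple T) :
  otuple t = Some s <-> forall i, tnth t i = Some (tnth s i).
Proof.
split=> [/otuple_inv -> i|h]; first by rewrite tnth_map.
by rewrite -(otuple_some s); congr otuple; apply: eq_from_tnth => i; rewrite h tnth_map.
Qed.

Lemma approximates_comp k m (f : pfun k) (g : 'I_k -> pfun m) F G :
  approximates F f -> (forall i, approximates (G i) (g i)) ->
  approximates (fun s l => let ys := [seq G i s l | i <- enum 'I_k] in
    if all (leq 1) ys then F s (map predn ys) else 0) (pcomposition f g).
Proof.
move=> [pF Fmon FE] hG.
have ysP s l : reflect (forall i, 0 < G i s l) (all (leq 1) [seq G i s l | i <- enum 'I_k]).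
  apply: (iffP allP) => [h i|h _ /mapP [i _ ->]] //.
  by apply: h; apply: map_f; rewrite mem_enum.
have Gmon s s' l : s <= s' -> all (leq 1) [seq G i s l | i <- enum 'I_k] ->
    [seq G i s' l | i <- enum 'I_k] = [seq G i s l | i <- enum 'I_k].
  move=> ss' /ysP h; apply: eq_map => i; have [_ mon _] := hG i.
  by have := h i; case E: (G i s l) => [|y] // _; apply: mon ss' E.
split.
- have pys : effective (fun p : nat * seq nat => [seq G i p.1 p.2 | i <- enum 'I_k]).
    elim: (enum _) => [|i e ih] /=; first by eff.
    by apply: eff_cons ih; have [] := hG i.
  apply: eff_if; last by eff.
    by apply: eff_all => //; eff.
  apply: (eff_app2 pF); eff.
  by apply: eff_map => //; apply: eff_predn; eff.
- move=> s s' l y ss' /=; case: ifP => // h; rewrite (Gmon _ _ _ ss') // h.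
  exact: Fmon.
move=> t y; rewrite /pcomposition; split.
  case E: (otuple _) => [u|] //= fu.
  have gu i : exists s, G i s t = (tnth u i).+1.
    have [_ _ GE] := hG i; apply/GE; move/otuple_tnthP: E => /(_ i).
    by rewrite tnth_mktuple.
  have [s sE] := (FE _ _).1 fu.
  pose S i := sval (cid (gu i)); pose s' := maxn s (\max_i S i).
  have us i : G i s' t = (tnth u i).+1.
    have [_ mon _] := hG i; apply: mon (svalP (cid (gu i))).
    by rewrite leq_max (leq_bigmax (F := S)) orbT.
  exists s'; have -> : all (leq 1) [seq G i s' t | i <- enum 'I_k].
    by apply/ysP => i; rewrite us.
  rewrite (_ : map _ _ = u); first by apply: Fmon sE; apply: leq_maxl.
  rewrite -map_comp (eq_map (g := tnth u)) ?map_tnth_enum // => i /=.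
  by rewrite us.
case=> s; case: ifP => // /ysP h Fs.
pose u := [tuple (G i s t).-1 | i < k].
suff -> : otuple [tuple g i t | i < k] = Some u.
  by apply/FE; exists s; rewrite -Fs -map_comp.
apply/otuple_tnthP => i; rewrite !tnth_mktuple.
by have [_ _ GE] := hG i; apply/GE; exists s; rewrite prednK.
Qed.

Lemma approximates_primrec k (f : pfun k) (g : pfun k.+2) F G :
  approximates F f -> approximates G g ->
  approximates (fun s l => nat_rect (fun=> nat) (F s (behead l))
    (fun n y => if y is y'.+1 then G s [:: n, y' & behead l] else 0)
    (nth 0 l 0)) (primrec f g).
Proof.
move=> [pF Fmon FE] [pG Gmon GE]; split.
- apply: eff_nat_rect.
  + by eff.
  + by apply: (eff_app2 pF); eff.
  + apply: eff_case_nat; [by eff | by eff |].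
    by apply: (eff_app2 pG); eff.
- move=> s s' l y ss'; elim: (nth 0 l 0) y => [|n ih] y /=; first exact: Fmon.
  by case: (nat_rect _ _ _ n) ih => // z /(_ _ erefl) ->; apply: Gmon.
move=> t; rewrite /primrec /thead (tnth_nth 0) /=.
elim: (nth 0 t 0) => [|n ih] y; first exact: FE.
split=> /= [|[s]].
  case Eh: (X in obind _ X) => [z|] //= /GE [s' sG]; have [s sE] := (ih z).1 Eh.
  exists (maxn s s'); set r := nat_rect _ _ _ n.
  suff -> : r = z.+1 by apply: Gmon sG; apply: leq_maxr.
  rewrite /r; elim: n z sE {ih r Eh sG} => [|n ih] z /=.
    by apply: Fmon; apply: leq_maxl.
  case: (nat_rect _ _ _ n) ih => // x /(_ _ erefl) ->.
  by apply: Gmon; apply: leq_maxl.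
case E: (nat_rect _ _ _ n) => [|z] // sG.
by rewrite ((ih z).2 _) /=; [apply/GE; exists s | exists s].
Qed.

(** The search stops at the first [y] whose approximation is 0 or 1, that is, still undefined or
    equal to zero. Only the second case gives an output, so an undefined value blocks everything
    after it, as minimization requires. *)
Lemma approximates_min k (f : pfun k.+1) (h : pfun k) F :
  approximates F f -> is_minimization f h ->
  approximates (fun s l => let y := find (fun y => F s (y :: l) <= 1) (iota 0 s) in
    if (y < s) && (F s (y :: l) == 1) then y.+1 else 0) h.
Proof.
move=> [pF Fmon FE] hE.
have findP s l y : (forall z, z < y -> 1 < F s (z :: l)) -> F s (y :: l) = 1 -> y < s ->
    find (fun y => F s (y :: l) <= 1) (iota 0 s) = y.
  move=> lty ey ys; apply/eqP; rewrite eqn_leq; apply/andP; split.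
    rewrite leqNgt; apply/negP => /(before_find 0).
    by rewrite nth_iota // add0n ey.
  rewrite leqNgt; apply/negP => fy.
  have fs : has (fun y => F s (y :: l) <= 1) (iota 0 s).
    by rewrite has_find size_iota (ltn_trans fy).
  have := nth_find 0 fs; rewrite nth_iota ?(ltn_trans fy) // add0n leqNgt.
  by rewrite lty.
have findV s l y : (let y := find (fun y => F s (y :: l) <= 1) (iota 0 s) in
    if (y < s) && (F s (y :: l) == 1) then y.+1 else 0) = y.+1 ->
    [/\ y < s, F s (y :: l) = 1 & forall z, z < y -> 1 < F s (z :: l)].
  rewrite /=; case: ifP => // /andP [fs /eqP fE] [<-]; split=> // z zf.
  have := before_find 0 zf; rewrite nth_iota ?(ltn_trans zf) // add0n => /negbT.
  by rewrite -ltnNge.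
split.
- have pfind : effective (fun p : nat * seq nat =>
      find (fun y => F p.1 (y :: p.2) <= 1) (iota 0 p.1)).
    apply: eff_find; last by eff.
    by eff; apply: (eff_app2 pF); eff.
  apply: eff_if; [|by eff..]; eff.
  by apply: (eff_app2 pF); eff.
- move=> s s' l y ss' /findV [ys ey lty].
  have lty' z : z < y -> 1 < F s' (z :: l).
    by move=> /lty; case E: (F s _) => [|n] // n1; rewrite (Fmon _ _ _ _ ss' E).
  have ey' := Fmon _ _ _ _ ss' ey; have ys' := leq_trans ys ss'.
  by rewrite /= (findP _ _ _ lty' ey' ys') ys' ey'.
move=> t y; split.
  move=> /hE [/FE [s sy] lty].
  (* A common stage by which all the computations below [y] have halted. *)
  have : exists s', forall z, z < y -> 1 < F s' (z :: t).
    elim: y lty {sy} => [|y ih] lty; first by exists 0.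
    have [z zy|s1 h1] := ih; first by apply: lty; apply: ltnW.
    have [w /FE [s2 h2]] := lty y (ltnSn y).
    exists (maxn s1 s2) => z; rewrite ltnS leq_eqVlt => /predU1P [->|/h1].
      by rewrite (Fmon _ _ _ _ (leq_maxr _ _) h2).
    by case E: (F s1 _) => [|n] // n1; rewrite (Fmon _ _ _ _ (leq_maxl _ _) E).
  move=> [s' h']; pose u := maxn y.+1 (maxn s s').
  have su : s <= u by rewrite !leq_max leqnn orbT.
  have su' : s' <= u by rewrite !leq_max leqnn !orbT.
  have yu : y < u by rewrite leq_max leqnn.
  have lu z : z < y -> 1 < F u (z :: t).
    by move=> /h'; case E: (F s' _) => [|n] // n1; rewrite (Fmon _ _ _ _ su' E).
  have eu := Fmon _ _ _ _ su sy.
  by exists u; rewrite /= (findP _ _ _ lu eu yu) yu eu.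
move=> [s /findV [ys ey lty]]; apply/hE; split; first by apply/FE; exists s.
move=> z /lty; case E: (F s _) => [|[|w]] // _.
by exists w; apply/FE; exists s.
Qed.

(** A form of Kleene's normal form theorem, by induction on the generation of [f]. For compositions,
    the approximations of the finitely many inner functions are picked by choice. *)
Lemma approximation k (f : pfun k) :
  partial_computable f -> exists F, approximates F f.
Proof.
elim=> {k f}.
- exists (fun=> fun=> 1); apply: (@approximates_total _ (fun=> 0)); eff.
- exists (fun=> fun l => (nth 0 l 0).+2).
  rewrite (_ : (fun t : 1.-tuple nat => _) = fun t : 1.-tuple nat => Some (nth 0 t 0).+1).
    by apply: (@approximates_total _ (fun l => (nth 0 l 0).+1)); eff.
  by apply/funext => t; rewrite /thead (tnth_nth 0).
- move=> k i; exists (fun=> fun l => (nth 0 l i).+1).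
  rewrite (_ : (fun t : k.-tuple nat => _) = fun t : k.-tuple nat => Some (nth 0 t i)).
    by apply: (@approximates_total _ (fun l => nth 0 l i)); eff.
  by apply/funext => t; rewrite (tnth_nth 0).
- move=> k m f g _ [F hF] _ hG.
  by eexists; apply: approximates_comp hF (fun i => svalP (cid (hG i))).
- by move=> k f g _ [F hF] _ [G hG]; eexists; apply: approximates_primrec hF hG.
- by move=> k f h _ [F hF] hE; eexists; apply: approximates_min hF hE.
Qed.

End Approximation.

(** * Unbounded search and c.e. sets *)

Definition search (P : nat -> bool) : option nat :=
  if pselect (exists w, P w) is left e then Some (ex_minn e) else None.

Lemma searchP (P : nat -> bool) w : search P = Some w -> P w.
Proof. by rewrite /search; case: pselect => // e [<-]; case: ex_minnP. Qed.

Lemma search_def (P : nat -> bool) w : P w -> search P.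
Proof. by rewrite /search; case: pselect => // h Pw; case: h; exists w. Qed.

Lemma search_pc (P : nat -> nat -> bool) :
  effective (fun p : nat * nat => P p.1 p.2) ->
  partial_computable (unary (fun i => search (P i))).
Proof.
move=> pP.
(* Minimization looks for a zero, hence the negation. *)
have pf : computable (fun t : 2.-tuple nat => ~~ P (nth 0 t 1) (nth 0 t 0) : nat).
  apply: (@computable_of_eff_seq 2 (fun l => ~~ P (nth 0 l 1) (nth 0 l 0) : nat)).
  eff.
  by apply: (eff_app pP (g := fun l : seq nat => (nth 0 l 1, nth 0 l 0)));
    eff.
apply: (pc_min pf) => t y; rewrite /unary /= /search; split.
  case: pselect => // e [<-]; case: ex_minnP => m Pm mmin; split; first by rewrite Pm.
  move=> z zm; exists 0; case E: (P _ z) => //.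
  by have := mmin _ E; rewrite leqNgt zm.
move=> [[Py] ymin]; have {}Py : P (nth 0 t 0) y by move: Py; case: (P _ y).
case: pselect => [e|[]]; last by exists y.
congr Some; case: ex_minnP => m Pm mmin; apply/eqP; rewrite eqn_leq mmin //=.
rewrite leqNgt; apply/negP => /ymin [w [/eqP]].
by rewrite Pm.
Qed.

Lemma search_ce (P : nat -> nat -> bool) :
  effective (fun p : nat * nat => P p.1 p.2) -> ce [set i | exists w, P i w].
Proof.
move=> pP; exists (fun i => search (P i)); first exact: search_pc.
apply/seteqP; split=> i /=; first by case=> w; apply: search_def.
by case E: (search _) => [w|] // _; exists w; apply: searchP.
Qed.

                                                             

(** * $\Delta_2$ sets as limits of computable guesses *)

Lemma eff_rel2 (T : countType) (R : nat -> nat -> Prop) (f g : T -> nat) :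
  computable_rel (binary R) -> effective f -> effective g ->
  effective (fun x => `[< R (f x) (g x) >]).
Proof.
move=> pR pf pg; apply: eff_of_pickle.
exact: (eff_binary (f := fun a b => `[< R a b >] : nat)).
Qed.

Lemma eff_rel3 (T : countType) (R : nat -> nat -> nat -> Prop) (f g h : T -> nat) :
  computable_rel (ternary R) -> effective f -> effective g -> effective h ->
  effective (fun x => `[< R (f x) (g x) (h x) >]).
Proof.
move=> pR pf pg ph; apply: eff_of_pickle.
exact: (eff_ternary (f := fun a b c => `[< R a b c >] : nat)).
Qed.

(** Both [C] and its complement have definitions of the form $\exists y \forall z$. The guess at
    stage [t] takes the least [y < t] that no [z < t] refutes as a witness for at least one side,
    and answers whether [y] still stands as a witness for membership. All numbers below the least
    true witness are refuted eventually, so the guess stabilizes. *)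
Lemma Delta2_limit (C : set nat) : Delta2 C ->
  exists2 c : nat -> nat -> bool, effective (fun p : nat * nat => c p.1 p.2) &
    forall x, exists t0, forall t, t0 <= t -> c x t = `[< C x >].
Proof.
move=> [[R1 pR1 CE1] [R2 pR2 CE2]].
pose r1 x y t := all (fun z => `[< R1 x y z >]) (iota 0 t).
pose r2 x y t := all (fun z => ~~ `[< R2 x y z >]) (iota 0 t).
pose l x t := [seq y <- iota 0 t | r1 x y t || r2 x y t].
pose c x t := if l x t is y :: _ then r1 x y t else false.
have pr (T : countType) (f g h : T -> nat) : effective f -> effective g -> effective h ->
    effective (fun p => r1 (f p) (g p) (h p)) /\ effective (fun p => r2 (f p) (g p) (h p)).
  have e (u : T -> nat) : effective u -> effective (fun p : T * nat => u p.1).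
    by move=> pu; apply: (eff_app pu); eff.
  move=> /[dup] pf /e pf1 /[dup] pg /e pg1 ph; split;
    apply: eff_all (eff_iota ph); eff; apply: eff_rel3; eff.
have pl : effective (fun p : nat * nat => l p.1 p.2).
  apply: eff_filter; last by eff.
  by apply: eff_orb; apply pr; eff.
exists c; first by apply: eff_case_seq => //; [eff | apply pr; eff].
move=> x.
have allN (r : nat -> bool) z t : ~~ r z -> z < t -> all r (iota 0 t) = false.
  by move=> rz zt; apply/negbTE/allPn; exists z; rewrite // mem_iota.
(* [Q y] says that [y] is a true witness, for membership or for non-membership. *)
pose Q y := `[< (forall z, R1 x y z) \/ (forall z, ~ R2 x y z) >].
have exQ : exists y, Q y.
  have [Cx|nCx] := pselect (C x).
    by have /CE1 [y Ry] := Cx; exists y; apply/asboolP; left.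
  move: nCx; rewrite CE2 -existsNP => -[y /forallNP Ry].
  by exists y; apply/asboolP; right.
case: (ex_minnP exQ) => y /asboolP Qy ymin.
have rejected w : w < y -> exists t0, forall t, t0 <= t -> ~~ (r1 x w t || r2 x w t).
  move=> wy; have : ~~ Q w by apply/negP => /ymin; rewrite leqNgt wy.
  move=> /asboolPn /not_orP [/existsNP [z1 n1] /existsNP [z2 /contrapT n2]].
  exists (maxn z1 z2).+1 => t; rewrite gtn_max => /andP [t1 t2].
  by rewrite /r1 /r2 (allN _ z1) ?(allN _ z2) //; [rewrite negbK|]; apply/asboolP.
have {rejected} [t1 t1P] : exists t0, forall t, t0 <= t ->
    forall w, w < y -> ~~ (r1 x w t || r2 x w t).
  elim: (y) rejected => [|v ih] h; first by exists 0.
  have [w wv|t1 h1] := ih; first by apply: h; apply: ltnW.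
  have [t2 h2] := h v (ltnSn v); exists (maxn t1 t2) => t; rewrite geq_max.
  by move=> /andP [/h1 h1' /h2 h2'] w; rewrite ltnS leq_eqVlt => /predU1P [->|/h1'].
have cE t : maxn t1 y.+1 <= t -> r1 x y t || r2 x y t -> c x t = r1 x y t.
  rewrite geq_max => /andP [/t1P lty yt] ry; rewrite /c /l.
  have -> : iota 0 t = iota 0 y ++ y :: iota y.+1 (t - y.+1).
    by rewrite -[in LHS](subnKC yt) addSnnS iotaD.
  rewrite filter_cat (eq_in_filter (a2 := pred0)) ?filter_pred0 /= ?ry //.
  by move=> w; rewrite mem_iota => /lty /negbTE.
case: Qy => hy.
  have Cx : C x by apply/CE1; exists y.
  exists (maxn t1 y.+1) => t tt; have r1t : r1 x y t.
    by apply/allP => z _; apply/asboolP.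
  by rewrite cE ?r1t // asboolT.
(* Here [y] survives on account of [r2]. It cannot witness membership, so [r1] fails from some stage
   on and the guess becomes false. *)
have nCx : ~ C x by move=> /CE2 /(_ y) [z]; apply: hy.
have [z1 n1] : exists z, ~ R1 x y z.
  by apply/existsNP => h; apply: nCx; apply/CE1; exists y.
exists (maxn z1.+1 (maxn t1 y.+1)) => t; rewrite geq_max => /andP [zt tt].
have r2t : r2 x y t by apply/allP => z _; apply/asboolP/hy.
by rewrite cE ?r2t ?orbT // asboolF // /r1 (allN _ z1) //; apply/asboolP.
Qed.

Lemma infinite_unbounded (C : set nat) b : infinite_set C -> exists2 i, C i & b <= i.
Proof.
move=> infC; apply: contrapT => h; apply: infC.
apply: (sub_finite_set (B := `I_b)); last exact: finite_II.
by move=> i Ci; rewrite /= ltnNge; apply/negP => bi; apply: h; exists i.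
Qed.

Lemma unbounded_infinite (C : set nat) :
  (forall b, exists2 i, C i & b <= i) -> infinite_set C.
Proof.
move=> h /finite_seqP [X CX].
have [i Ci] := h (\max_(x <- X) x).+1; move: Ci; rewrite CX /= => iX.
by rewrite ltnNge (@leq_bigmax_seq _ _ xpredT id).
Qed.

(** * Uniformization over a $\Delta_2$ cohesive set *)

Section Uniformization.
Variables (C : set nat) (U : nat -> nat -> nat -> bool).
Hypothesis cohC : cohesive C.
Hypothesis effU : effective (fun p : nat * (nat * nat) => U p.1 p.2.1 p.2.2).
Hypothesis Udec : forall s s' i w, s <= s' -> U s' i w -> U s i w.
Hypothesis Uinf : forall s, infinite_set (C `&` [set i | exists w, U s i w]).

Variable c : nat -> nat -> bool.
Hypothesis effc : effective (fun p : nat * nat => c p.1 p.2).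
Hypothesis cC : forall x, exists t0, forall t, t0 <= t -> c x t = `[< C x >].

                                                                               
                                                                            
                                                                          
                                                                         
                                                                    
                                                            
(** Stage [t] is read as a proposal [(s, (i, w))]: requirement [s] asks for the value [w] at place
    [i]. Further entries of the decoded sequence are ignored, so each proposal recurs at arbitrarily
    late stages. *)
Definition candidate t : nat * (nat * nat) :=
  let l := CodeSeq.decode t in (nth 0 l 0, (nth 0 l 1, nth 0 l 2)).

(** Only places up to [i] may block a proposal at [i]: the guesses on this finite range settle,
    whereas an unbounded range could contain some wrong guess at every stage. *)
Definition meets s i t (q : nat * (nat * nat)) :=
  [&& s <= q.2.1, q.2.1 <= i, c q.2.1 t & U s q.2.1 q.2.2].

Definition accepted t (q : nat * (nat * nat)) (G : seq (nat * (nat * nat))) :=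
  [&& q.1 <= q.2.1, U q.1 q.2.1 q.2.2, c q.2.1 t,
      ~~ has (fun q' => q'.2.1 == q.2.1) G & ~~ has (meets q.1 q.2.1 t) G].

(** Assignments are only added. This makes the resulting function partial computable although the
    guesses about [C] keep changing. *)
Definition state t : seq (nat * (nat * nat)) :=
  nat_rect (fun=> seq (nat * (nat * nat))) [::] (fun t G =>
    if accepted t (candidate t) G then candidate t :: G else G) t.

Lemma eff_state (T : countType) (f : T -> nat) :
  effective f -> effective (fun x => state (f x)).
Proof.
move=> pf; apply: eff_nat_rect => //; first by eff.
have pcand (S : countType) (g : S -> nat) :
    effective g -> effective (fun x => candidate (g x)).
  by move=> pg; rewrite /candidate; eff.
have pcand1 : effective (fun p : T * (nat * seq (nat * (nat * nat))) =>
    candidate p.2.1) by apply: pcand; eff.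
have pcand2 : effective (fun p : T * (nat * seq (nat * (nat * nat))) *
    (nat * (nat * nat)) => candidate p.1.2.1) by apply: pcand; eff.
rewrite /accepted /meets; apply: eff_if; [|by eff..]; eff.
- by apply: (eff_app3 effU); eff.
- by apply: (eff_app2 effc); eff.
- by apply: eff_has; eff.
- apply: eff_has; eff; first by apply: (eff_app2 effc); eff.
  by apply: (eff_app3 effU); eff.
Qed.

Lemma state_mono t t' q : t <= t' -> q \in state t -> q \in state t'.
Proof.
move=> /subnKC <-; elim: (t' - t) => [|n ih] qt; first by rewrite addn0.
by rewrite addnS /=; case: ifP => _; rewrite ?inE ih ?orbT.
Qed.

Lemma state_valid t q : q \in state t -> q.1 <= q.2.1 /\ U q.1 q.2.1 q.2.2.
Proof.
elim: t => //= t ih; case: ifP => // /and5P [le Uq _ _ _].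
by rewrite inE => /predU1P [->|/ih].
Qed.

Lemma state_uniq t : uniq [seq q.2.1 | q <- state t].
Proof.
elim: t => //= t ih; case: ifP => //= /and5P [_ _ _ h _].
by rewrite ih andbT -has_pred1 has_map.
Qed.

Lemma state_inj t t' q q' : q \in state t -> q' \in state t' ->
  q.2.1 = q'.2.1 -> q = q'.
Proof.
move=> /(state_mono (leq_maxl t t')) + /(state_mono (leq_maxr t t')).
move=> qG qG' e; apply/eqP.
elim: (state _) (state_uniq (maxn t t')) qG qG' => //= p G ih /andP [pG uG].
rewrite !inE => /predU1P [qp|qG] /predU1P [qp'|qG'].
- by rewrite qp qp'.
- by move/negP: pG; rewrite -qp e; case; apply: (map_f (fun q => q.2.1)).
- by move/negP: pG; rewrite -qp' -e; case; apply: (map_f (fun q => q.2.1)).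
- exact: ih.
Qed.

Lemma candidate_cofinal q t : exists2 t', t <= t' & candidate t' = q.
Proof.
case: q => s [i w]; exists (CodeSeq.code [:: s; i; w; t]).
  have := CodeSeq.ltn_code [:: s; i; w; t].
  by rewrite /= andbT => /and4P [_ _ _ /ltnW].
by rewrite /candidate CodeSeq.codeK.
Qed.

(** Strong induction on [s]. The bound in the second part is what the induction feeds on: smaller
    requirements claim only finitely many places, so one of their claims cannot occupy a large place
    that [s] needs. *)
Lemma requirement_met s :
  exists i w t, [/\ s <= i, C i, (exists s', (s', (i, w)) \in state t) & U s i w] /\
    exists b, forall t i w, (s, (i, w)) \in state t -> i <= b.
Proof.
elim/ltn_ind: s => s ih.
have [b bP] : exists b, forall s' t i w, s' < s -> (s', (i, w)) \in state t -> i <= b.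
  elim: (s) ih => [|r IH] ih; first by exists 0.
  have [v vr|b bP] := IH; first by apply: ih; apply: ltnW.
  have [_ [_ [_ [_ [b' b'P]]]]] := ih r (ltnSn r).
  exists (maxn b b') => s' t i w; rewrite ltnS leq_eqVlt leq_max.
  by case/predU1P => [->|sr] h; [rewrite (b'P _ _ _ h) orbT | rewrite (bP _ _ _ _ sr h)].
(* A place in [C] beyond everything ever claimed by smaller requirements. *)
have [i [Ci [w Uw]] ib] := infinite_unbounded (maxn b.+1 s) (@Uinf s).
move: ib; rewrite geq_max => /andP [bi si].
have [t0 t0P] : exists t0, forall t i', t0 <= t -> i' <= i -> c i' t = `[< C i' >].
  elim: (i) => [|n [t1 h1]].
    by have [t0 h] := cC 0; exists t0 => t i'; rewrite leqn0 => tt /eqP ->; apply: h.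
  have [t2 h2] := cC n.+1; exists (maxn t1 t2) => t i'; rewrite geq_max.
  move=> /andP [tt1 tt2]; rewrite leq_eqVlt => /predU1P [->|]; first exact: h2.
  exact: h1.
have [t1 t01 t1E] := candidate_cofinal (s, (i, w)) t0.
have ci : c i t1 by rewrite t0P //; apply/asboolP.
(* At stage [t1] the guesses up to [i] are correct and [(s, (i, w))] is proposed. Either [s] is
   already served at a place up to [i], or [i] carries a value already, or the proposal is accepted;
   in each case [s] is served by an element of [C]. *)
have [q qG /and4P [sq qi Cq Uq]] : exists2 q, q \in state t1.+1 &
    [&& s <= q.2.1, q.2.1 <= i, `[< C q.2.1 >] & U s q.2.1 q.2.2].
  have [/hasP [q qG]|nmeet] := boolP (has (meets s i t1) (state t1)).
    move=> /and4P [sq qi cq Uq]; exists q; first by apply: state_mono qG.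
    by rewrite sq qi Uq -(t0P t1) // cq.
  have [/hasP [q qG /eqP qi]|used] := boolP (has (fun q' => q'.2.1 == i) (state t1)).
    exists q; first by apply: state_mono qG.
    rewrite qi si leqnn asboolT //=; have [_ Uq] := state_valid qG.
    (* As [i] exceeds [b], the value there was assigned for a requirement not smaller than [s], so
       it serves [s] by monotonicity. *)
    rewrite -qi; apply: Udec Uq; rewrite leqNgt; apply/negP => qs.
    have := bP q.1 t1 q.2.1 q.2.2 qs; rewrite -!surjective_pairing => /(_ qG).
    by rewrite qi leqNgt bi.
  exists (s, (i, w)) => /=; last by rewrite si leqnn Uw asboolT.
  by rewrite t1E ifT ?mem_head // /accepted /= si Uw ci used nmeet.
exists q.2.1, q.2.2, t1.+1; split.
  split=> //; first by apply/asboolP.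
  by exists q.1; rewrite -!surjective_pairing.
(* After stage [t1] the entry [q] blocks every proposal of [s] beyond [i], since its place stays
   guessed to be in [C]. *)
have after t i' w' : (s, (i', w')) \in state t -> (s, (i', w')) \in state t1.+1 \/ i' <= i.
  elim: t => // t IH /=; case: ifP => // acc; rewrite inE => /predU1P [e|/IH //].
  have [tt1|t1t] := leqP t t1.
    left; have h : (s, (i', w')) \in state t.+1 by rewrite /= acc e mem_head.
    exact: (@state_mono t.+1 t1.+1).
  have /and5P [_ _ _ _ nmeet] := acc.
  right; rewrite leqNgt; apply/negP => ii'; move/negP: nmeet; rewrite -e; apply.
  apply/hasP; exists q; first exact: state_mono qG.
  have ct : c q.2.1 t by rewrite t0P // (leq_trans t01 (ltnW t1t)).
  by rewrite /meets sq Uq ct (leq_trans qi (ltnW ii')).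
exists (maxn i (\max_(q <- state t1.+1) q.2.1)) => t i' w' /after [h|ii'].
  by rewrite leq_max (@leq_bigmax_seq _ _ xpredT (fun q => q.2.1) _ h) // orbT.
by rewrite leq_max ii'.
Qed.

Definition assigned i t := has (fun q => q.2.1 == i) (state t).

Definition assignment i t :=
  (head (0, (0, 0)) [seq q <- state t | q.2.1 == i]).2.2.

Lemma assignmentE i t : assigned i t ->
  exists s, (s, (i, assignment i t)) \in state t.
Proof.
rewrite /assigned /assignment has_filter.
case E: [seq _ <- _ | _] => [//|q l] _ /=.
have : q \in [seq q <- state t | q.2.1 == i] by rewrite E mem_head.
rewrite mem_filter => /andP [/eqP <- qG]; exists q.1.
by rewrite -!surjective_pairing.
Qed.

Definition witness i := omap (assignment i) (search (assigned i)).

Lemma witness_pc : partial_computable (unary witness).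
Proof.
apply: pc_omap; last first.
  apply: search_pc; rewrite /assigned.
  by apply: eff_has; [eff | apply: eff_state; eff].
apply: computable_binary_of_eff; rewrite /assignment.
have pl : effective (fun p : nat * nat => [seq q <- state p.2 | q.2.1 == p.1]).
  by apply: eff_filter; [eff | apply: eff_state; eff].
rewrite (_ : (fun p => _) = fun p =>
  (nth (0, (0, 0)) [seq q <- state p.2 | q.2.1 == p.1] 0).2.2).
  by eff; eff.
by apply/funext => p; rewrite nth0.
Qed.

Lemma witnessE s i w t : (s, (i, w)) \in state t -> witness i = Some w.
Proof.
move=> qG; have /search_def : assigned i t by apply/hasP; exists (s, (i, w)).
rewrite /witness; case E: (search _) => [t'|] // _ /=.
have [s' h] := assignmentE (searchP E).
by have [_ ->] := state_inj h qG erefl.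
Qed.

Lemma witness_valid i w : witness i = Some w -> exists s, U s i w.
Proof.
rewrite /witness; case E: (search _) => [t|] //= [<-].
have [s /state_valid [_ Us]] := assignmentE (searchP E).
by exists s.
Qed.

(** The set is c.e., so by cohesiveness it suffices that it meets [C] beyond every [b]. Requirement
    [maxn s b] provides such an element, and its value satisfies [U s] by monotonicity. *)
Lemma witness_almost s :
  almost_subset C [set i | exists2 w, witness i = Some w & U s i w].
Proof.
have [infC cohC'] := cohC.
have ceW : ce [set i | exists2 w, witness i = Some w & U s i w].
  rewrite (_ : [set i | _] = [set i | exists t, assigned i t && U s i (assignment i t)]).
    apply: (search_ce (P := fun i t => assigned i t && U s i (assignment i t))).
    apply: eff_andb.
      by rewrite /assigned; apply: eff_has; [eff | apply: eff_state; eff].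
    apply: (eff_app3 effU); eff; rewrite /assignment.
    under eq_fun do rewrite -nth0.
    by eff; apply: eff_filter; [eff | apply: eff_state; eff].
  apply/seteqP; split=> i /= [].
    move=> w; rewrite /witness; case E: (search _) => [t|] //= [<-] Us.
    by exists t; rewrite (searchP E).
  move=> t /andP [at_ Us]; exists (assignment i t) => //.
  by have [s' /witnessE] := assignmentE at_.
case: (cohC' _ ceW) => // h; exfalso; move: h; apply: unbounded_infinite => b.
have [i [w [t [[si Ci [s' qG] Us] _]]]] := requirement_met (maxn s b).
move: si; rewrite geq_max => /andP [si bi]; exists i => //; split=> //; apply.
exists w; first exact: witnessE qG.
by apply: Udec Us; apply: leq_maxl.
Qed.

End Uniformization.

(** A choice of witnesses for each [s] separately would be a mere search; here a single function
    serves all [s] at once, with finitely many exceptions in [C] for each. *)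
Lemma uniformization (C : set nat) (U : nat -> nat -> nat -> bool) :
  Delta2 C -> cohesive C ->
  effective (fun p : nat * (nat * nat) => U p.1 p.2.1 p.2.2) ->
  (forall s s' i w, s <= s' -> U s' i w -> U s i w) ->
  (forall s, almost_subset C [set i | exists w, U s i w]) ->
  exists2 v : nat -> option nat, partial_computable (unary v) &
    (forall i w, v i = Some w -> U 0 i w) /\
    forall s, almost_subset C [set i | exists2 w, v i = Some w & U s i w].
Proof.
move=> D2C cohC effU Udec Ualm; have [c effc cC] := Delta2_limit D2C.
have Uinf s : infinite_set (C `&` [set i | exists w, U s i w]).
  move=> fin; case: cohC => + _; apply.
  apply: (sub_finite_set _ (_ : finite_set ((C `&` [set i | exists w, U s i w]) `|`
    (C `\` [set i | exists w, U s i w])))); last first.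
    by rewrite finite_setU; split=> //; apply: Ualm.
  by move=> i Ci; have [h|h] := pselect (exists w, U s i w); [left|right].
exists (witness U c); first exact: witness_pc.
split=> [i w /witness_valid [s]|s]; first exact: Udec.
exact: witness_almost.
Qed.

                                          

(** * Prenex formulas, duals, injectivity of Gödel numbers, and instantiation *)

Lemma code_gt (s : seq nat) y : y \in s -> y < CodeSeq.code s.
Proof. exact: (allP (CodeSeq.ltn_code s)). Qed.

Lemma code_inj : injective CodeSeq.code.
Proof. exact: can_inj CodeSeq.codeK. Qed.

Section Syntax.
Variable L : language.

Section Prenex.
Variable K : Type.

Fixpoint prenex m (A : formula L K m) : bool :=
  match A with Ex B => prenex B | All B => prenex B | A => qfree A end.

Lemma qfree_prenex m (A : formula L K m) : qfree A -> prenex A.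
Proof. by case: A. Qed.

Fixpoint prefix_length m (A : formula L K m) : nat :=
  match A with Ex B => (prefix_length B).+1 | All B => (prefix_length B).+1 | _ => 0 end.

Lemma qfree_prefix_length m (A : formula L K m) : qfree A -> prefix_length A = 0.
Proof. by case: A. Qed.

Scheme is_Sigma_mind := Minimality for is_Sigma Sort Prop
  with is_Pi_mind := Minimality for is_Pi Sort Prop.

Lemma is_Sigma_Pi_ind (P Q : nat -> forall m, formula L K m -> Prop) :
  (forall m (A : formula L K m), qfree A -> P 0 m A /\ Q 0 m A) ->
  (forall n m (A : formula L K m), is_Pi n A -> Q n m A -> P n.+1 m A) ->
  (forall n m (A : formula L K m.+1), is_Sigma n.+1 A -> P n.+1 _ A -> P n.+1 _ (Ex A)) ->
  (forall n m (A : formula L K m), is_Sigma n A -> P n m A -> Q n.+1 m A) ->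
  (forall n m (A : formula L K m.+1), is_Pi n.+1 A -> Q n.+1 _ A -> Q n.+1 _ (All A)) ->
  forall n m (A : formula L K m), (is_Sigma n A -> P n m A) /\ (is_Pi n A -> Q n m A).
Proof.
move=> h0 h1 h2 h3 h4 n m A; split.
  by apply: (is_Sigma_mind (P := P) (P0 := Q)) => // ? ? qA; have [] := h0 _ _ qA.
by apply: (is_Pi_mind (P := P) (P0 := Q)) => // ? ? qA; have [] := h0 _ _ qA.
Qed.

Lemma is_Sigma_inv n m (A : formula L K m) : is_Sigma n A ->
  match n with
  | 0 => qfree A : Prop
  | n'.+1 => is_Pi n' A \/ (if A is Ex B then is_Sigma n'.+1 B else False)
  end.
Proof. by move=> h; case: n m A / h => // n m A; [left|right]. Qed.

Lemma is_Pi_inv n m (A : formula L K m) : is_Pi n A ->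
  match n with
  | 0 => qfree A : Prop
  | n'.+1 => is_Sigma n' A \/ (if A is All B then is_Pi n'.+1 B else False)
  end.
Proof. by move=> h; case: n m A / h => // n m A; [left|right]. Qed.

Lemma is_Sigma_Pi_prenex n m (A : formula L K m) :
  (is_Sigma n A -> prenex A) /\ (is_Pi n A -> prenex A).
Proof.
move: n m A; apply: (is_Sigma_Pi_ind (P := fun _ _ A => prenex A)
  (Q := fun _ _ A => prenex A)) => // m A qA.
by split; apply: qfree_prenex.
Qed.

Lemma is_Sigma_Pi_succ n m (A : formula L K m) :
  (is_Sigma n A -> is_Sigma n.+1 A) /\ (is_Pi n A -> is_Pi n.+1 A).
Proof.
move: n m A; apply: (is_Sigma_Pi_ind (P := fun n _ A => is_Sigma n.+1 A)
  (Q := fun n _ A => is_Pi n.+1 A)) => [m A qA|n m A _|n m A _|n m A _|n m A _].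
- by split; [apply: Sigma_Pi; apply: Pi_qfree | apply: Pi_Sigma; apply: Sigma_qfree].
- exact: Sigma_Pi.
- exact: Sigma_Ex.
- exact: Pi_Sigma.
- exact: Pi_All.
Qed.

Lemma qfree_Sigma_Pi n m (A : formula L K m) : qfree A -> is_Sigma n A /\ is_Pi n A.
Proof.
move=> qA; elim: n => [|n [? ?]]; first by split; constructor.
by split; apply is_Sigma_Pi_succ.
Qed.

(** An existential formula may also have entered $\Sigma_{n+1}$ through $\Pi_n$, hence from
    $\Sigma_{n-1}$. This drops two levels at a time, so the induction is strong and the result is
    lifted back by [is_Sigma_Pi_succ]. *)
Lemma is_Sigma_Ex_inv n m (A : formula L K m.+1) :
  is_Sigma n.+1 (Ex A) -> is_Sigma n.+1 A.
Proof.
elim/ltn_ind: n => n ih /is_Sigma_inv [/is_Pi_inv|//].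
case: n ih => [//|n ih] [] // /[dup] /is_Sigma_inv; case: n ih => [//|n] ih _.
by move=> /ih h; apply is_Sigma_Pi_succ; apply is_Sigma_Pi_succ; apply: h.
Qed.

Lemma is_Pi_All_inv n m (A : formula L K m.+1) : is_Pi n (All A) -> is_Pi n A.
Proof.
elim/ltn_ind: n => -[|n] ih /is_Pi_inv // [] // /is_Sigma_inv.
case: n ih => // n ih [] // /ih h.
by apply is_Sigma_Pi_succ; apply is_Sigma_Pi_succ; apply: h.
Qed.

Lemma is_Sigma_Pi_notEx n m (A : formula L K m) :
  is_Sigma n.+1 A -> (if A is Ex _ then false else true) -> is_Pi n A.
Proof. by move=> /is_Sigma_inv [//|]; case: A. Qed.

(** Negation pushed through the quantifier prefix. [is_Sigma] and [is_Pi] contain only prenex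
    formulas, so plain [Not] would leave them. *)
Fixpoint dual m (A : formula L K m) : formula L K m :=
  match A with Ex B => All (dual B) | All B => Ex (dual B) | A => Not A end.

Lemma sat_dual (M : structure L) (par : K -> M) m (e : m.-tuple M)
    (A : formula L K m) : sat par e (dual A) <-> ~ sat par e A.
Proof.
elim: A e => //= {}m A ih e.
  split=> [h [a sa]|h a]; first by have /ih := h a.
  by apply/ih => sa; apply: h; exists a.
split=> [[a /ih na] h|/existsNP [a na]]; first exact: na (h a).
by exists a; apply/ih.
Qed.

Lemma is_Sigma_Pi_dual n m (A : formula L K m) :
  (is_Sigma n A -> is_Pi n (dual A)) /\ (is_Pi n A -> is_Sigma n (dual A)).
Proof.
move: n m A; apply: (is_Sigma_Pi_ind (P := fun n _ A => is_Pi n (dual A))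
  (Q := fun n _ A => is_Sigma n (dual A))) => [m A qA|n m A _|n m A _|n m A _|n m A _].
- by split; constructor; case: A qA.
- exact: Pi_Sigma.
- exact: Pi_All.
- exact: Sigma_Pi.
- exact: Sigma_Ex.
Qed.

End Prenex.

Section Injectivity.
Variables (K : Type) (kc : K -> nat).
Hypothesis kc_inj : injective kc.

Lemma gterm_inj m : injective (@gterm L K kc m).
Proof.
elim=> [i|c|f ts ih] [j|d|g us] /code_inj //.
- by case=> /val_inj ->.
- by case=> /kc_inj ->.
case=> /(pcan_inj pickleK) fg; subst g => /eq_in_map h.
by congr App; apply/funext => i; apply: ih; apply: h; rewrite mem_enum.
Qed.

Lemma gform_inj m : injective (@gform L K kc m).
Proof.
elim=> {m} m.
- by move=> t u [t' u'|r us|B|B B'|B B'|B|B] /code_inj // [/gterm_inj -> /gterm_inj ->].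
- move=> r ts [t' u'|r' us|B|B B'|B B'|B|B] /code_inj //.
  case=> /(pcan_inj pickleK) rr; subst r' => /eq_in_map h.
  congr Rel; apply/funext => i; apply: gterm_inj; apply: h.
  by rewrite mem_enum.
- by move=> A ih [t' u'|r' us|B|B B'|B B'|B|B] /code_inj // [/ih ->].
- by move=> A ih A' ih' [t' u'|r' us|B|B B'|B B'|B|B] /code_inj // [/ih -> /ih' ->].
- by move=> A ih A' ih' [t' u'|r' us|B|B B'|B B'|B|B] /code_inj // [/ih -> /ih' ->].
- by move=> A ih [t' u'|r' us|B|B B'|B B'|B|B] /code_inj // [/ih ->].
- by move=> A ih [t' u'|r' us|B|B B'|B B'|B|B] /code_inj // [/ih ->].
Qed.

End Injectivity.

Section Instantiation.
Variables (K X : Type) (par : K -> X).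

                                                                              
(** A variable is sent either to a variable or to a constant from [X]. Below a quantifier only the
    former has to be shifted. *)
Definition lift_sub m d (s : 'I_m -> 'I_d + X) (i : 'I_m.+1) : 'I_d.+1 + X :=
  if unlift ord0 i is Some j then
    match s j with inl l => inl (lift ord0 l) | inr a => inr a end
  else inl ord0.

Fixpoint tinst m d (s : 'I_m -> 'I_d + X) (t : term L K m) : term L X d :=
  match t with
  | Var i => match s i with inl j => Var _ _ j | inr a => Cst _ _ a end
  | Cst c => Cst _ _ (par c)
  | App f ts => App (fun i => tinst s (ts i))
  end.

Fixpoint finst m d (s : 'I_m -> 'I_d + X) (A : formula L K m) : formula L X d :=
  match A with
  | Eq t u => Eq (tinst s t) (tinst s u)
  | Rel r ts => Rel (fun i => tinst s (ts i))
  | Not A => Not (finst s A)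
  | And A B => And (finst s A) (finst s B)
  | Or A B => Or (finst s A) (finst s B)
  | Ex A => Ex (finst (lift_sub s) A)
  | All A => All (finst (lift_sub s) A)
  end.

Lemma qfree_finst m d (s : 'I_m -> 'I_d + X) A : qfree (finst s A) = qfree A.
Proof.
by elim: A d s => //= {}m A ihA B ihB d s; rewrite ihA ihB.
Qed.

Lemma is_Sigma_Pi_finst n m (A : formula L K m) :
  (is_Sigma n A -> forall d (s : 'I_m -> 'I_d + X), is_Sigma n (finst s A)) /\
  (is_Pi n A -> forall d (s : 'I_m -> 'I_d + X), is_Pi n (finst s A)).
Proof.
move: n m A; apply: (is_Sigma_Pi_ind
  (P := fun n m A => forall d (s : 'I_m -> 'I_d + X), is_Sigma n (finst s A))
  (Q := fun n m A => forall d (s : 'I_m -> 'I_d + X), is_Pi n (finst s A)))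
  => [m A qA|n m A _ ih d s|n m A _ ih d s|n m A _ ih d s|n m A _ ih d s].
- by split=> d s; constructor; rewrite qfree_finst.
- exact: Sigma_Pi.
- exact: Sigma_Ex.
- exact: Pi_Sigma.
- exact: Pi_All.
Qed.

End Instantiation.

Section InstantiationSemantics.
Variables (K : Type) (M : structure L) (par : K -> M).

Definition merge m d (s : 'I_m -> 'I_d + M) (e : d.-tuple M) : m.-tuple M :=
  [tuple match s i with inl j => tnth e j | inr a => a end | i < m].

Lemma merge_lift m d (s : 'I_m -> 'I_d + M) (e : d.-tuple M) a :
  merge (lift_sub s) [tuple of a :: e] = [tuple of a :: merge s e].
Proof.
apply: eq_from_tnth => i; rewrite tnth_mktuple /lift_sub.
case: unliftP => [j|] ->; last by rewrite !tnth0.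
by rewrite tnthS tnth_mktuple; case: (s j) => // l; rewrite tnthS.
Qed.

Lemma eval_tinst m d (s : 'I_m -> 'I_d + M) (e : d.-tuple M) (t : term L K m) :
  eval id e (tinst par s t) = eval par (merge s e) t.
Proof.
elim: t => [i|c|f ts ih] //=.
  by rewrite tnth_mktuple; case: (s i).
by congr fint; apply: eq_from_tnth => i; rewrite !tnth_mktuple ih.
Qed.

Lemma sat_finst m d (s : 'I_m -> 'I_d + M) (e : d.-tuple M) (A : formula L K m) :
  sat id e (finst par s A) <-> sat par (merge s e) A.
Proof.
elim: A d s e => {m} m.
- by move=> t u d s e /=; rewrite !eval_tinst.
- move=> r ts d s e /=.
  rewrite (_ : [tuple _ | i < _] = [tuple eval par (merge s e) (ts i) | i < rar r]) //.
  by apply: eq_from_tnth => i; rewrite !tnth_mktuple eval_tinst.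
- by move=> A ih d s e /=; rewrite ih.
- by move=> A ih B ih' d s e /=; rewrite ih ih'.
- by move=> A ih B ih' d s e /=; rewrite ih ih'.
- move=> A ih d s e /=; split=> -[a]; first by move/ih; rewrite merge_lift; exists a.
  by rewrite -merge_lift => /ih; exists a.
- move=> A ih d s e /=; split=> h a; first by have /ih := h a; rewrite merge_lift.
  by apply/ih; rewrite merge_lift.
Qed.

End InstantiationSemantics.

End Syntax.

                                     

(** * Syntactic operations on Gödel numbers *)

Arguments CodeSeq.code : simpl never.

Section CodeOperations.

Implicit Types (h : seq nat).

Definition tag x := nth 0 (CodeSeq.decode x) 0.
Definition arg x := nth 0 (CodeSeq.decode x) 1.

Lemma eff_tag (T : countType) (f : T -> nat) :
  effective f -> effective (fun x => tag (f x)).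
Proof. by move=> pf; apply: eff_nth; [apply: eff_decode | eff]. Qed.

Lemma eff_arg (T : countType) (f : T -> nat) :
  effective f -> effective (fun x => arg (f x)).
Proof. by move=> pf; apply: eff_nth; [apply: eff_decode | eff]. Qed.

Lemma tagE a s : tag (CodeSeq.code (a :: s)) = a.
Proof. by rewrite /tag CodeSeq.codeK. Qed.

Lemma argE a b s : arg (CodeSeq.code [:: a, b & s]) = b.
Proof. by rewrite /arg CodeSeq.codeK. Qed.

Lemma nth_hist (f : nat -> nat) a s y :
  y \in s -> nth 0 (mkseq f (CodeSeq.code (a :: s))) y = f y.
Proof. by move=> ys; rewrite nth_mkseq // code_gt // inE ys orbT. Qed.

                                                                          
                                                                                  
                                                                             
                                                                                 
                                           
(** For [c = (d, (env, pars))], variables below [d] count as bound and stay, the variable [d + j]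
    becomes the constant named by entry [j] of [env], and a parameter is replaced through [pars].
    The list [h] holds the results at smaller codes. *)
Definition term_inst_step (c : nat * (seq nat * seq nat)) (x : nat) h :=
  let l := CodeSeq.decode x in
  if tag x == 0 then
    if arg x < c.1 then x else CodeSeq.code [:: 1; nth 0 c.2.1 (arg x - c.1)]
  else if tag x == 1 then CodeSeq.code [:: 1; nth 0 c.2.2 (arg x)]
  else CodeSeq.code [:: 2, arg x & [seq nth 0 h y | y <- behead (behead l)]].

Definition term_inst := cov term_inst_step.

(** The number [d] is not raised below a quantifier. In a prenex formula every term lies below the
    whole prefix, so [d] can be set in advance to the number of variables bound there. *)
Definition form_inst_step (c : nat * (seq nat * seq nat)) (x : nat) h :=
  let l := behead (CodeSeq.decode x) in
  if tag x == 0 then CodeSeq.code (0 :: [seq term_inst c y | y <- l])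
  else if tag x == 1 then
    CodeSeq.code [:: 1, arg x & [seq term_inst c y | y <- behead l]]
  else CodeSeq.code (tag x :: [seq nth 0 h y | y <- l]).

Definition form_inst := cov form_inst_step.

Definition prefix_code (x : nat) := cov (fun (_ : nat) x h =>
  if (tag x == 5) || (tag x == 6) then (nth 0 h (arg x)).+1 else 0) 0 x.

Definition ex_prefix_code (x : nat) := cov (fun (_ : nat) x h =>
  if tag x == 5 then (nth 0 h (arg x)).+1 else 0) 0 x.

Definition strip_code (x : nat) := cov (fun (_ : nat) x h =>
  if tag x == 5 then nth 0 h (arg x) else x) 0 x.

Definition dual_code (x : nat) := cov (fun (_ : nat) x h =>
  if tag x == 5 then CodeSeq.code [:: 6; nth 0 h (arg x)]
  else if tag x == 6 then CodeSeq.code [:: 5; nth 0 h (arg x)]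
  else CodeSeq.code [:: 2; x]) 0 x.

Ltac eff_codes := repeat first
  [ progress eff
  | match goal with
    | |- effective (fun x => tag (@?f x)) => apply: (@eff_tag _ f)
    | |- effective (fun x => arg (@?f x)) => apply: (@eff_arg _ f)
    end ].

Lemma eff_term_inst (T : countType) (c : T -> nat * (seq nat * seq nat)) (f : T -> nat) :
  effective c -> effective f -> effective (fun x => term_inst (c x) (f x)).
Proof.
apply: eff_cov; rewrite /term_inst_step; apply: eff_if; first by eff_codes.
  by apply: eff_if; eff_codes.
apply: eff_if; eff_codes.
by apply: eff_map; eff_codes.
Qed.

Lemma eff_form_inst (T : countType) (c : T -> nat * (seq nat * seq nat)) (f : T -> nat) :
  effective c -> effective f -> effective (fun x => form_inst (c x) (f x)).
Proof.
apply: eff_cov; rewrite /form_inst_step; apply: eff_if; eff_codes.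
  by apply: eff_map; [apply: eff_term_inst; eff | eff_codes].
apply: eff_if; eff_codes; apply: eff_map; eff_codes.
by apply: eff_term_inst; eff.
Qed.

Lemma eff_prefix_code (T : countType) (f : T -> nat) :
  effective f -> effective (fun x => prefix_code (f x)).
Proof.
by apply: (eff_cov _ (eff_const T 0)); apply: eff_if; eff_codes.
Qed.

Lemma eff_ex_prefix_code (T : countType) (f : T -> nat) :
  effective f -> effective (fun x => ex_prefix_code (f x)).
Proof.
by apply: (eff_cov _ (eff_const T 0)); apply: eff_if; eff_codes.
Qed.

Lemma eff_strip_code (T : countType) (f : T -> nat) :
  effective f -> effective (fun x => strip_code (f x)).
Proof.
by apply: (eff_cov _ (eff_const T 0)); apply: eff_if; eff_codes.
Qed.

Lemma eff_dual_code (T : countType) (f : T -> nat) :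
  effective f -> effective (fun x => dual_code (f x)).
Proof.
apply: (eff_cov _ (eff_const T 0)); apply: eff_if; eff_codes.
by apply: eff_if; eff_codes.
Qed.

Variable (L : language).

Section Unfolding.
Variables (K : Type) (kc : K -> nat) (m : nat).

Lemma gterm_Var i : gterm kc (Var L K i : term L K m) = CodeSeq.code [:: 0; i : nat].
Proof. by []. Qed.
Lemma gterm_Cst c : gterm kc (Cst L m c) = CodeSeq.code [:: 1; kc c].
Proof. by []. Qed.
Lemma gterm_App f (ts : 'I_(far f) -> term L K m) : gterm kc (App ts) =
  CodeSeq.code [:: 2, pickle f & [seq gterm kc (ts i) | i <- enum 'I_(far f)]].
Proof. by []. Qed.
Lemma gform_Eq (t u : term L K m) :
  gform kc (Eq t u) = CodeSeq.code [:: 0; gterm kc t; gterm kc u].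
Proof. by []. Qed.
Lemma gform_Rel r (ts : 'I_(rar r) -> term L K m) : gform kc (Rel ts) =
  CodeSeq.code [:: 1, pickle r & [seq gterm kc (ts i) | i <- enum 'I_(rar r)]].
Proof. by []. Qed.
Lemma gform_Not (B : formula L K m) :
  gform kc (Not B) = CodeSeq.code [:: 2; gform kc B].
Proof. by []. Qed.
Lemma gform_And (B B' : formula L K m) :
  gform kc (And B B') = CodeSeq.code [:: 3; gform kc B; gform kc B'].
Proof. by []. Qed.
Lemma gform_Or (B B' : formula L K m) :
  gform kc (Or B B') = CodeSeq.code [:: 4; gform kc B; gform kc B'].
Proof. by []. Qed.
Lemma gform_Ex (B : formula L K m.+1) :
  gform kc (Ex B) = CodeSeq.code [:: 5; gform kc B].
Proof. by []. Qed.
Lemma gform_All (B : formula L K m.+1) :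
  gform kc (All B) = CodeSeq.code [:: 6; gform kc B].
Proof. by []. Qed.

Definition godel_unfold := (gterm_Var, gterm_Cst, gterm_App, (gform_Eq, gform_Rel, gform_Not),
  (gform_And, gform_Or, gform_Ex, gform_All)).

End Unfolding.

Section Correctness.
Variables (K : Type) (kc : K -> nat).

Lemma prefix_code_gform m (A : formula L K m) :
  prefix_code (gform kc A) = prefix_length A.
Proof.
rewrite /prefix_code; elim: A => {}m *; rewrite covE !godel_unfold !tagE //.
all: by rewrite argE nth_hist ?mem_head //=; congr _.+1.
Qed.

Lemma dual_code_gform m (A : formula L K m) :
  dual_code (gform kc A) = gform kc (dual A).
Proof.
rewrite /dual_code; elim: A => {}m *; rewrite covE !godel_unfold ?tagE //.
all: by rewrite argE nth_hist ?mem_head //; congr (CodeSeq.code [:: _; _]).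
Qed.

Lemma ex_prefix_code_Ex m (A : formula L K m.+1) :
  ex_prefix_code (gform kc (Ex A)) = (ex_prefix_code (gform kc A)).+1.
Proof.
rewrite /ex_prefix_code covE !godel_unfold ?tagE argE.
by rewrite nth_hist ?mem_head.
Qed.

Lemma strip_code_Ex m (A : formula L K m.+1) :
  strip_code (gform kc (Ex A)) = strip_code (gform kc A).
Proof.
rewrite /strip_code covE !godel_unfold ?tagE argE.
by rewrite nth_hist ?mem_head.
Qed.

Lemma strip_code_notEx m (A : formula L K m) :
  (if A is Ex _ then false else true) ->
  strip_code (gform kc A) = gform kc A /\ ex_prefix_code (gform kc A) = 0.
Proof.
by case: A => // *; rewrite /strip_code /ex_prefix_code !covE !godel_unfold ?tagE.
Qed.

End Correctness.

Section CorrectnessInst.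
Variables (K X : Type) (kc : K -> nat) (xc : X -> nat) (par : K -> X).
Variables (env pars : seq nat).

Definition represents m d (s : 'I_m -> 'I_d + X) :=
  forall i, match s i with
    | inl j => j = i :> nat
    | inr a => (d <= i) /\ nth 0 env (i - d) = xc a
    end.

Lemma represents_lift m d (s : 'I_m -> 'I_d + X) :
  represents s -> represents (lift_sub s).
Proof.
move=> hs i; rewrite /lift_sub; case: unliftP => [j|] -> //.
have := hs j; case: (s j) => [l|a]; first by rewrite !lift0 => ->.
by rewrite lift0.
Qed.

Variable b : nat.
Hypothesis parsE : forall c, kc c < b -> nth 0 pars (kc c) = xc (par c).

(** A constant occurring in a term has a number below the code of the term, so [pars] has to be
    correct only below [b]. This is what lets finitely many parameters suffice for each formula. *)
Lemma term_inst_gterm m d (s : 'I_m -> 'I_d + X) (t : term L K m) :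
  represents s -> gterm kc t <= b ->
  term_inst (d, (env, pars)) (gterm kc t) = gterm xc (tinst par s t).
Proof.
move=> hs; rewrite /term_inst; elim: t => [i|c|f ts ih] tb; rewrite covE /term_inst_step.
- rewrite !godel_unfold tagE argE /=.
  have := hs i; case: (s i) => [j <-|a [di ->]]; first by rewrite ltn_ord.
  by rewrite ltnNge di.
- rewrite !godel_unfold tagE argE /= parsE //.
  by apply: leq_trans tb; apply: code_gt; rewrite !inE eqxx orbT.
rewrite !godel_unfold tagE argE CodeSeq.codeK ?godel_unfold.
congr (CodeSeq.code [:: _, _ & _]); rewrite /= -map_comp.
apply/eq_in_map => i _ /=.
have lt : gterm kc (ts i) < gterm kc (App ts).
  by apply: code_gt; rewrite !inE; apply/orP; right; apply/orP; right;
    apply: map_f; rewrite mem_enum.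
by rewrite nth_mkseq ?ih // (leq_trans (ltnW lt)).
Qed.

(** The invariant is the equation for [k]: passing a quantifier moves one unit from the length of
    the prefix to [d], so [k] stays fixed. *)
Lemma form_inst_gform m d (s : 'I_m -> 'I_d + X) (A : formula L K m) k :
  represents s -> prenex A -> k = d + prefix_length A -> gform kc A <= b ->
  form_inst (k, (env, pars)) (gform kc A) = gform xc (finst par s A).
Proof.
rewrite /form_inst.
have pref0 m' (B : formula L K m') : qfree B -> prenex B /\ prefix_length B = 0.
  by move=> qB; split; [apply: qfree_prenex | apply: qfree_prefix_length].
elim: A d s k => {m} m.
- move=> t u d s k hs _; rewrite addn0 => -> Ab; rewrite covE /form_inst_step.
  have [tb ub] : gterm kc t <= b /\ gterm kc u <= b.
    by split; apply: leq_trans (ltnW _) Ab; apply: code_gt; rewrite !inE eqxx ?orbT.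
  rewrite !godel_unfold tagE CodeSeq.codeK /=.
  by rewrite !(term_inst_gterm hs).
- move=> r ts d s k hs _; rewrite addn0 => -> Ab; rewrite covE /form_inst_step.
  rewrite !godel_unfold tagE argE CodeSeq.codeK ?godel_unfold.
  congr (CodeSeq.code [:: _, _ & _]); rewrite /= -map_comp.
  apply/eq_in_map => i _ /=; apply: term_inst_gterm => //.
  apply: leq_trans (ltnW _) Ab; apply: code_gt; rewrite !inE.
  by apply/orP; right; apply/orP; right; apply: map_f; rewrite mem_enum.
- move=> A ih d s k hs qA kE Ab; rewrite covE /form_inst_step.
  rewrite !godel_unfold tagE CodeSeq.codeK /= nth_hist ?mem_head //.
  have [pA lA] := pref0 _ A qA; rewrite (ih _ s) ?lA //.
  by apply: leq_trans (ltnW _) Ab; apply: code_gt; rewrite !inE eqxx orbT.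
- move=> A ihA B ihB d s k hs /andP [qA qB] kE Ab; rewrite covE /form_inst_step.
  have [ab bb] : gform kc A <= b /\ gform kc B <= b.
    by split; apply: leq_trans (ltnW _) Ab; apply: code_gt; rewrite !inE eqxx ?orbT.
  rewrite !godel_unfold tagE CodeSeq.codeK /=.
  rewrite !nth_hist ?inE ?eqxx ?orbT //.
  have [pA lA] := pref0 _ _ qA; have [pB lB] := pref0 _ _ qB.
  by rewrite (ihA _ s) ?(ihB _ s) ?lA ?lB.
- move=> A ihA B ihB d s k hs /andP [qA qB] kE Ab; rewrite covE /form_inst_step.
  have [ab bb] : gform kc A <= b /\ gform kc B <= b.
    by split; apply: leq_trans (ltnW _) Ab; apply: code_gt; rewrite !inE eqxx ?orbT.
  rewrite !godel_unfold tagE CodeSeq.codeK /=.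
  rewrite !nth_hist ?inE ?eqxx ?orbT //.
  have [pA lA] := pref0 _ _ qA; have [pB lB] := pref0 _ _ qB.
  by rewrite (ihA _ s) ?(ihB _ s) ?lA ?lB.
- move=> A ih d s k hs pA kE Ab; rewrite covE /form_inst_step.
  rewrite !godel_unfold tagE CodeSeq.codeK /= nth_hist ?mem_head //.
  rewrite (ih _ (lift_sub s)) //; first exact: represents_lift.
    by rewrite kE addnS.
  by apply: leq_trans (ltnW _) Ab; apply: code_gt; rewrite !inE eqxx orbT.
- move=> A ih d s k hs pA kE Ab; rewrite covE /form_inst_step.
  rewrite !godel_unfold tagE CodeSeq.codeK /= nth_hist ?mem_head //.
  rewrite (ih _ (lift_sub s)) //; first exact: represents_lift.
    by rewrite kE addnS.
  by apply: leq_trans (ltnW _) Ab; apply: code_gt; rewrite !inE eqxx orbT.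
Qed.

End CorrectnessInst.

                                                                                 
                       
(** * Checking truth against the elementary diagram *)

(** The diagram lists true $\Sigma_n$ sentences, so a $\Pi_n$ formula is tested by the absence of
    its instantiated dual. *)
Definition pi_check (D : nat -> bool) x (env pars : seq nat) :=
  ~~ D (dual_code (form_inst (prefix_code x, (env, pars)) x)).

(** The list [ys] proposes values for the leading existential block, innermost variable first, as de
    Bruijn indices demand. For a $\Sigma_{n+1}$ formula, what remains after that block is
    $\Pi_n$. *)
Definition sigma_check (D dm : nat -> bool) x (env pars ys : seq nat) :=
  [&& size ys == ex_prefix_code x, all dm ys &
      pi_check D (strip_code x) (ys ++ env) pars].

Section Truth.
Variables (n : nat) (A : nat_structure L) (K : Type) (kc : K -> nat) (par : K -> A).

Lemma elementary_diagramP (B : formula L A 0) : is_Sigma n B ->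
  elementary_diagram n A (gform (@value L A) B) <-> sat id [tuple] B.
Proof.
move=> SB; split=> [[B' [_ sB'] /gform_inj <-//]|sB]; last by exists B.
Qed.

Let D x := `[< elementary_diagram n A x >].
Let dm x := dom A x.

Lemma pi_checkP m (e : m.-tuple A) (pars : seq nat) (B : formula L K m) :
  is_Pi n B ->
  (forall c, kc c < gform kc B -> nth 0 pars (kc c) = value (par c)) ->
  pi_check D (gform kc B) (map (@value L A) e) pars <-> sat par e B.
Proof.
move=> PB parsE; pose s (i : 'I_m) : 'I_0 + A := inr (tnth e i).
have hs : represents (@value L A) (map (@value L A) e) s.
  move=> i /=; split=> //; rewrite subn0 (nth_map (tnth e i)) ?size_tuple //.
  by congr value; rewrite [RHS](tnth_nth (tnth e i)).
rewrite /pi_check (form_inst_gform parsE hs) ?prefix_code_gform //; last first.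
  by case: (is_Sigma_Pi_prenex n B) => _; apply.
rewrite dual_code_gform.
have Pi := (is_Sigma_Pi_finst par n B).2 PB _ s.
have Sd := (is_Sigma_Pi_dual n (finst par s B)).2 Pi.
have -> : (~~ D (gform (@value L A) (dual (finst par s B)))) <->
    ~ sat id [tuple] (dual (finst par s B)).
  rewrite -(rwP negP); split=> h h'; apply: h; first by apply/asboolP/elementary_diagramP.
  by move/asboolP/elementary_diagramP: h'; apply.
rewrite sat_dual sat_finst.
rewrite (_ : merge s [tuple] = e); first by split=> [/contrapT|h /(_ h)].
by apply: eq_from_tnth => i; rewrite tnth_mktuple.
Qed.

Lemma sigma_checkP m (e : m.-tuple A) (pars : seq nat) (B : formula L K m) :
  is_Sigma n.+1 B ->
  (forall c, kc c < gform kc B -> nth 0 pars (kc c) = value (par c)) ->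
  (exists ys, sigma_check D dm (gform kc B) (map (@value L A) e) pars ys) <->
  sat par e B.
Proof.
have notEx m' (e' : m'.-tuple A) (B' : formula L K m') :
    (if B' is Ex _ then false else true) -> is_Sigma n.+1 B' ->
    (forall c, kc c < gform kc B' -> nth 0 pars (kc c) = value (par c)) ->
    (exists ys, sigma_check D dm (gform kc B') (map (@value L A) e') pars ys) <->
    sat par e' B'.
  move=> nE SB parsE; have PB := is_Sigma_Pi_notEx SB nE.
  rewrite -(pi_checkP e' PB parsE) /sigma_check.
  have [-> ->] := strip_code_notEx kc nE.
  by split=> [[ys /and3P [/eqP/size0nil -> _]]//|]; exists [::].
elim: B e => {m} m; try by move=> *; apply: notEx.
move=> B ih e SB parsE; have SB' := is_Sigma_Ex_inv SB.
have parsE' c : kc c < gform kc B -> nth 0 pars (kc c) = value (par c).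
  move=> cB; apply: parsE; apply: ltn_trans cB _; apply: code_gt.
  by rewrite !inE eqxx orbT.
have ih' a := ih [tuple of a :: e] SB' parsE'.
split.
  move=> [ys]; rewrite /sigma_check ex_prefix_code_Ex strip_code_Ex.
  (* The witness of the outermost quantifier is the last entry of the list. *)
  case/lastP: ys => [|ys a]; first by rewrite andFb.
  rewrite size_rcons eqSS all_rcons => /and3P [sz /andP [da dys]].
  rewrite cat_rcons => h; exists (exist _ a da); apply/ih'; exists ys.
  by rewrite /sigma_check sz dys.
move=> [a /ih' [ys /and3P [sz dys h]]]; exists (rcons ys (value a)).
rewrite /sigma_check ex_prefix_code_Ex strip_code_Ex size_rcons eqSS sz all_rcons dys.
by rewrite cat_rcons h !andbT; apply: (svalP a).
Qed.

End Truth.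
End CodeOperations.

                                     

(** * The Łoś theorem for $\Sigma_{n+1}$ formulas *)

Section Los.
Variables (L : language) (n : nat) (A : nat -> nat_structure L) (C : set nat).
Hypothesis compA : uniformly_computable A.
Hypothesis decA : computable_rel (binary (fun i => elementary_diagram n (A i))).
Hypothesis cohC : cohesive C.

Let D i x := `[< elementary_diagram n (A i) x >].
Let dm i x := dom (A i) x.

Lemma eff_dom (T : countType) (f g : T -> nat) :
  effective f -> effective g -> effective (fun x => dm (f x) (g x)).
Proof.
have [pdom _ _] := compA; move=> pf pg.
have := eff_rel2 (R := fun i a => dom (A i) a) pdom pf pg; congr effective; apply/funext => x.
by apply/asboolP/idP.
Qed.

Lemma eff_pi_check (T : countType) (i x : T -> nat) (env pars : T -> seq nat) :
  effective i -> effective x -> effective env -> effective pars ->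
  effective (fun c => pi_check (D (i c)) (x c) (env c) (pars c)).
Proof.
move=> pi px penv ppars; rewrite /pi_check; eff; apply: (eff_rel2 decA) => //.
apply: eff_dual_code; apply: eff_form_inst => //; eff.
exact: eff_prefix_code.
Qed.

Lemma eff_sigma_check (T : countType) (i x : T -> nat) (env pars ys : T -> seq nat) :
  effective i -> effective x -> effective env -> effective pars -> effective ys ->
  effective (fun c => sigma_check (D (i c)) (dm (i c)) (x c) (env c) (pars c) (ys c)).
Proof.
move=> pi px penv ppars pys; rewrite /sigma_check; eff.
- exact: eff_ex_prefix_code.
- by apply: eff_all => //; apply: eff_dom; [apply: (eff_app pi) | ]; eff.
- by apply: eff_pi_check => //; [apply: eff_strip_code | eff].
Qed.

Definition default i : A i :=
  exist _ (sval (cid (dom_nonempty (A i)))) (svalP (cid (dom_nonempty (A i)))).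

(** Totalized for use in semantic statements only. The default appears at finitely many elements of
    [C] at most, so it affects no statement about almost all of [C]. *)
Definition val_at (phi : cohesive_fun A C) i : A i := odflt (default i) (phi i).

Lemma val_atE (phi : cohesive_fun A C) i : phi i -> phi i = Some (val_at phi i).
Proof. by rewrite /val_at; case: (phi i). Qed.

Lemma values_at_val k (phi : k.-tuple (cohesive_fun A C)) i :
  (forall j, tnth phi j i) ->
  values_at phi i = Some [tuple val_at (tnth phi j) i | j < k].
Proof.
move=> h; apply/otuple_tnthP => j; rewrite !tnth_mktuple.
exact: val_atE.
Qed.

Lemma almost_dom k (phi : k.-tuple (cohesive_fun A C)) :
  almost_subset C [set i | forall j, tnth phi j i].
Proof. exact: almost_subset_forall (fun j => cval_dom (tnth phi j)). Qed.

Lemma almost_setT : almost_subset C setT.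
Proof. by rewrite /almost_subset setDT. Qed.

Lemma almost_iff (X Y Z : set nat) : almost_subset C Z ->
  (forall i, Z i -> (X i <-> Y i)) -> almost_subset C X <-> almost_subset C Y.
Proof.
move=> CZ h; split=> CX; apply: almost_subsetS (almost_subsetI CZ CX);
  by move=> i [Zi]; apply h.
Qed.

Lemma almost_consistent (X : set nat) :
  almost_subset C X -> almost_subset C (~` X) -> False.
Proof.
move=> CX CnX; case: cohC => + _; apply.
have := almost_subsetI CX CnX; rewrite setICr /almost_subset setD0.
exact.
Qed.

(** The way elements of the product are built: [v] is the outcome of a search, and [out] extracts
    from it an element of the domain. *)
Lemma cohesive_fun_of (v : nat -> option nat) (out : nat -> nat -> nat) :
  partial_computable (unary v) -> effective (fun p : nat * nat => out p.1 p.2) ->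
  (forall i w, v i = Some w -> dom (A i) (out i w)) ->
  almost_subset C [set i | v i] ->
  exists chi : cohesive_fun A C, forall i w, v i = Some w ->
    value (val_at chi i) = out i w.
Proof.
move=> pv pout vdom vC.
pose f i : option (A i) := obind insub (omap (out i) (v i)).
have fE i : omap (@value L (A i)) (f i) = omap (out i) (v i).
  by rewrite /f; case E: (v i) => [w|] //=; rewrite (insubT _ (vdom _ _ E)).
have pf : partial_computable (unary (fun i => omap (@value L (A i)) (f i))).
  rewrite (_ : (fun i => _) = fun i => omap (out i) (v i)); last exact/funext.
  by apply: pc_omap => //; apply: computable_binary_of_eff.
have fC : almost_subset C [set i | f i].
  by apply: almost_subsetS vC => i /=; have := fE i; case: (f i); case: (v i).
exists (CohesiveFun pf fC) => i w vi; have := fE i; rewrite vi /val_at /=.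
by case: (f i) => //= a [].
Qed.

Lemma cohesive_fun_inhabited : inhabited (cohesive_fun A C).
Proof.
pose T i w := dm i w.
have [||||chi _] := @cohesive_fun_of (fun i => search (T i)) (fun _ w => w).
- by apply: search_pc; apply: eff_dom; eff.
- by eff.
- by move=> i w /searchP.
- apply: almost_subsetS almost_setT => i _; apply: search_def.
  exact: (svalP (cid (dom_nonempty (A i)))).
by constructor.
Qed.

Section ParameterizedTypes.
Variable psi : nat -> cohesive_fun A C.
Variable Psi : nat -> nat -> nat -> nat.
Hypothesis effPsi : effective (fun p : nat * (nat * nat) => Psi p.1 p.2.1 p.2.2).
Hypothesis PsiS : forall t t' l i y, t <= t' -> Psi t l i = y.+1 -> Psi t' l i = y.+1.
Hypothesis PsiE : forall l i y,
  omap (@value L (A i)) (psi l i) = Some y <-> exists t, Psi t l i = y.+1.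

Variables (K : Type) (kc : K -> nat).
Hypothesis kc_inj : injective kc.

Let P : structure L := cohesive_product C compA.
Let cls (phi : cohesive_fun A C) : P := (\pi_(cohesive_carrier A C) phi)%qT.
Variable par : K -> P.
Hypothesis parE : forall c, par c = cls (psi (kc c)).

Definition par_at i (c : K) : A i := val_at (psi (kc c)) i.
Definition vals_at m (phi : m.-tuple (cohesive_fun A C)) i : m.-tuple (A i) :=
  [tuple of [seq val_at f i | f <- phi]].

Lemma Psi_value t l i : 0 < Psi t l i -> value (val_at (psi l) i) = (Psi t l i).-1.
Proof.
move=> Pp; have : omap (@value L (A i)) (psi l i) = Some (Psi t l i).-1.
  by apply/PsiE; exists t; rewrite prednK.
by rewrite /val_at; case: (psi l i) => //= a [].
Qed.

Lemma Psi_pos_mono t t' l i : t <= t' -> 0 < Psi t l i -> 0 < Psi t' l i.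
Proof. by case E: (Psi t l i) => [|y] // tt' _; rewrite (PsiS tt' E). Qed.

Lemma Psi_ready b i : (forall l, l < b -> psi l i) ->
  exists t, forall l, l < b -> 0 < Psi t l i.
Proof.
elim: b => [|b ih] h; first by exists 0.
have [l lb|t1 h1] := ih; first by apply: h; apply: ltnW.
have [t2 h2] : exists t, Psi t b i = (value (val_at (psi b) i)).+1.
  by apply/PsiE; rewrite val_atE // h.
exists (maxn t1 t2) => l; rewrite ltnS leq_eqVlt => /predU1P [->|/h1].
  by rewrite (PsiS (leq_maxr _ _) h2).
exact: Psi_pos_mono (leq_maxl _ _).
Qed.

Definition param_codes t i b := [seq (Psi t l i).-1 | l <- iota 0 b].

Lemma eff_param_codes (T : countType) (t i b : T -> nat) :
  effective t -> effective i -> effective b ->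
  effective (fun c => param_codes (t c) (i c) (b c)).
Proof.
move=> pt pi pb; apply: eff_map; last by eff.
by apply: eff_predn; apply: (eff_app3 effPsi);
  [apply: (eff_app pt) | | apply: (eff_app pi)]; eff.
Qed.

Lemma param_codesE t i b : (forall l, l < b -> 0 < Psi t l i) ->
  forall c, kc c < b -> nth 0 (param_codes t i b) (kc c) = value (par_at i c).
Proof.
move=> h c cb; rewrite (nth_map 0) ?size_iota // nth_iota // add0n.
by rewrite -Psi_value // h.
Qed.

Lemma almost_params b : almost_subset C [set i | forall l, l < b -> psi l i].
Proof.
have := almost_subset_forall (fun l : 'I_b => cval_dom (psi l)).
by apply: almost_subsetS => i h l lb; apply: (h (Ordinal lb)).
Qed.

                                                                              
                 
(** Stated for relations rather than formulas, to cover both $\Sigma_{n+1}$ formulas and negations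
    of $\Pi_n$ formulas. *)
Definition semidecidable b m (S : forall i, m.-tuple (A i) -> Prop) :=
  exists2 Q : nat -> seq nat * seq nat -> nat -> bool,
    effective (fun p : nat * ((seq nat * seq nat) * nat) => Q p.1 p.2.1 p.2.2) &
    forall i (e : m.-tuple (A i)) pars,
      (forall c, kc c < b -> nth 0 pars (kc c) = value (par_at i c)) ->
      S i e <-> exists y, Q i (map (@value L (A i)) e, pars) y.

Lemma semidecidable_sigma m (B : formula L K m) : is_Sigma n.+1 B ->
  semidecidable (gform kc B) (fun i e => sat (par_at i) e B).
Proof.
move=> SB; exists (fun i c y =>
    sigma_check (D i) (dm i) (gform kc B) c.1 c.2 (CodeSeq.decode y)).
  by apply: eff_sigma_check; eff.
move=> i e pars hpars; rewrite -(sigma_checkP e SB hpars); split=> -[ys h].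
  by exists (CodeSeq.code ys); rewrite CodeSeq.codeK.
by exists (CodeSeq.decode ys).
Qed.

Lemma semidecidable_not_pi m (B : formula L K m) : is_Pi n B ->
  semidecidable (gform kc B) (fun i e => ~ sat (par_at i) e B).
Proof.
move=> PB; exists (fun i c y => ~~ pi_check (D i) (gform kc B) c.1 c.2).
  by eff; apply: eff_pi_check; eff.
move=> i e pars hpars; rewrite -(pi_checkP e PB hpars); split.
  by move=> /negP; exists 0.
by move=> [_ /negP].
Qed.

(** The procedure [T] waits for the coordinates of [phi] and the parameters below [b] to converge at
    [i] before it runs [Q]. Convergent approximations give the exact values, so it is sound at every
    [i]; it is complete wherever all these functions are defined, which is almost everywhere on
    [C]. *)
Lemma semidecidable_at b k m (S : forall i, (k + m).-tuple (A i) -> Prop)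
    (phi : m.-tuple (cohesive_fun A C)) : semidecidable b S ->
  exists2 T : nat -> seq nat -> nat -> bool,
    effective (fun p : nat * (seq nat * nat) => T p.1 p.2.1 p.2.2) &
    (forall i (e : k.-tuple (A i)) w, T i (map (@value L (A i)) e) w ->
      S i [tuple of e ++ vals_at phi i]) /\
    almost_subset C [set i | forall e : k.-tuple (A i),
      S i [tuple of e ++ vals_at phi i] ->
      exists w, T i (map (@value L (A i)) e) w].
Proof.
move=> [Q pQ QE].
pose F j := sval (cid (approximation (cval_pc (tnth phi j)))).
have hF j : approximates (F j) (unary (fun i => omap (@value L (A i)) (tnth phi j i))).
  exact: (svalP (cid (approximation (cval_pc (tnth phi j))))).
pose env t i := [seq F j t [:: i] | j <- enum 'I_m].
(* The number [w] codes a stage for the approximations and a witness for [Q]. *)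
pose T i e w := let l := CodeSeq.decode w in let t := nth 0 l 0 in
  [&& all (leq 1) (env t i), all (fun l => 0 < Psi t l i) (iota 0 b) &
      Q i (e ++ map predn (env t i), param_codes t i b) (nth 0 l 1)].
have envE t i : all (leq 1) (env t i) ->
    map predn (env t i) = map (@value L (A i)) (vals_at phi i).
  move=> /allP h; rewrite /env -map_comp /vals_at /= -map_comp.
  rewrite -[in RHS](map_tnth_enum phi) -[RHS]map_comp; apply: eq_map => j /=.
  have Fp : 0 < F j t [:: i] by apply: h; apply: map_f; rewrite mem_enum.
  have [_ _ FE] := hF j.
  have : unary (fun i => omap (@value L (A i)) (tnth phi j i)) [tuple i] =
      Some (F j t [:: i]).-1 by apply/FE; exists t; rewrite prednK.
  by rewrite /unary /= /val_at; case: (tnth phi j i) => //= a [].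
have env_mono t t' i : t <= t' -> all (leq 1) (env t i) -> all (leq 1) (env t' i).
  move=> tt' /allP h; apply/allP => _ /mapP [j _ ->]; have [_ FS _] := hF j.
  have : 0 < F j t [:: i] by apply: h; apply: map_f; rewrite mem_enum.
  by case E: (F j t _) => [|y] // _; rewrite (FS _ _ _ _ tt' E).
exists T.
  rewrite /T.
  have pl : effective (fun p : nat * (seq nat * nat) => nth 0 (CodeSeq.decode p.2.2) 0).
    by eff.
  have penv : effective (fun p : nat * (seq nat * nat) =>
      env (nth 0 (CodeSeq.decode p.2.2) 0) p.1).
    rewrite /env; elim: (enum _) => [|j s ih] /=; first by eff.
    apply: eff_cons ih; have [pF _ _] := hF j.
    by apply: (eff_app2 pF); eff.
  eff.
  - by apply: eff_all => //; eff.
  - by apply: eff_all; eff; apply: (eff_app3 effPsi); eff.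
  - apply: (eff_app3 pQ); eff.
    + by apply: eff_map => //; apply: eff_predn; eff.
    + by apply: eff_param_codes; eff.
split.
  move=> i e w /and3P [envp /allP Psip h].
  have h' l : l < b -> 0 < Psi (nth 0 (CodeSeq.decode w) 0) l i.
    by move=> lb; apply: Psip; rewrite mem_iota.
  apply/(QE i _ _ (param_codesE h')); exists (nth 0 (CodeSeq.decode w) 1).
  by rewrite /= map_cat -(envE _ _ envp).
apply: almost_subsetS (almost_subsetI (almost_dom phi) (almost_params b)).
move=> i [/= phii psii] e Se.
have [t1 t1P] := Psi_ready psii.
have [t2 t2P] : exists t, all (leq 1) (env t i).
  have tj j : exists t, F j t [:: i] = (value (val_at (tnth phi j) i)).+1.
    by have [_ _ FE] := hF j; apply/(FE [tuple i]); rewrite /unary /= val_atE.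
  exists (\max_j (sval (cid (tj j)))); apply/allP => _ /mapP [j _ ->].
  have [_ FS _] := hF j.
  by rewrite (FS _ _ _ _ (leq_bigmax (F := fun j => sval (cid (tj j))) j) (svalP (cid (tj j)))).
pose t := maxn t1 t2.
have h' l : l < b -> 0 < Psi t l i.
  by move=> /t1P; apply: Psi_pos_mono; apply: leq_maxl.
have envp : all (leq 1) (env t i) by apply: env_mono t2P; apply: leq_maxr.
have /(QE i _ _ (param_codesE h')) [y Qy] := Se.
exists (CodeSeq.code [:: t; y]); rewrite /T CodeSeq.codeK /= envp envE //.
rewrite -map_cat Qy andbT; apply/allP => l; rewrite mem_iota; exact: h'.
Qed.

(** Cohesiveness is applied to the c.e. set on which [T] succeeds. If [C] almost avoids it,
    completeness of [T] turns this into failure of [S]. *)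
Lemma semidecidable_decided b m (S : forall i, m.-tuple (A i) -> Prop)
    (phi : m.-tuple (cohesive_fun A C)) : semidecidable b S ->
  almost_subset C [set i | S i (vals_at phi i)] \/
  almost_subset C [set i | ~ S i (vals_at phi i)].
Proof.
move=> /(@semidecidable_at b 0 m S phi) [T pT [Tsound Tcompl]].
have tE i : [tuple of [tuple] ++ vals_at phi i] = vals_at phi i.
  by apply: val_inj.
have pT' : effective (fun p : nat * nat => T p.1 [::] p.2).
  by apply: (eff_app3 pT); eff.
have [_ /(_ _ (search_ce (P := fun i => T i [::]) pT'))] := cohC; case=> h; [left|right].
  by apply: almost_subsetS h => i [w /(Tsound i [tuple])]; rewrite tE.
apply: almost_subsetS (almost_subsetI h Tcompl) => i [/= nw +] Si.
by move=> /(_ [tuple]); rewrite tE => /(_ Si).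
Qed.

(** Searching simultaneously for [a] and for a success of [T] is a partial computable choice of [a],
    defined almost everywhere on [C]. *)
Lemma semidecidable_witness b m (S : forall i, m.+1.-tuple (A i) -> Prop)
    (phi : m.-tuple (cohesive_fun A C)) : semidecidable b S ->
  almost_subset C [set i | exists a, S i [tuple of a :: vals_at phi i]] ->
  exists chi, almost_subset C [set i | S i (vals_at [tuple of chi :: phi] i)].
Proof.
move=> /(@semidecidable_at b 1 m S phi) [T pT [Tsound Tcompl]] hS.
have tE i a : [tuple of [tuple a] ++ vals_at phi i] = [tuple of a :: vals_at phi i].
  by apply: val_inj.
pose T' i w := let l := CodeSeq.decode w in
  dm i (nth 0 l 0) && T i [:: nth 0 l 0] (nth 0 l 1).
have pT' : effective (fun p : nat * nat => T' p.1 p.2).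
  by rewrite /T'; eff; [apply: eff_dom | apply: (eff_app3 pT)]; eff.
have almT' : almost_subset C [set i | search (T' i)].
  apply: almost_subsetS (almost_subsetI hS Tcompl) => i [/= [a Sa]].
  move=> /(_ [tuple a]); rewrite tE => /(_ Sa) [w Tw].
  apply: (@search_def _ (CodeSeq.code [:: value a; w])).
  by rewrite /T' CodeSeq.codeK /= Tw andbT; apply: (svalP a).
have [|||chi chiE] := @cohesive_fun_of (fun i => search (T' i))
    (fun _ w => nth 0 (CodeSeq.decode w) 0) _ _ _ almT'.
- exact: search_pc.
- by eff.
- by move=> i w /searchP /andP [].
exists chi; apply: almost_subsetS almT' => i /=.
case E: (search _) => [w|] // _; have /andP [_] := searchP E.
rewrite -(chiE _ _ E) => /(Tsound i [tuple val_at chi i]); rewrite tE.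
by congr (S i _); apply: val_inj.
Qed.

Lemma evalE m (phi : m.-tuple (cohesive_fun A C)) (t : term L K m) :
  exists2 tau : cohesive_fun A C, eval par [tuple of map cls phi] t = cls tau &
    almost_subset C [set i | val_at tau i = eval (par_at i) (vals_at phi i) t].
Proof.
elim: t => [j|c|f ts ih].
- exists (tnth phi j); first by rewrite /= tnth_map.
  by apply: almost_subsetS almost_setT => i _ /=; rewrite tnth_map.
- exists (psi (kc c)); first exact: parE.
  by apply: almost_subsetS almost_setT.
pose tau j := sval (cid2 (ih j)).
have tauE j : eval par [tuple of map cls phi] (ts j) = cls (tau j).
  by rewrite /tau; case: cid2.
have tauC j : almost_subset C
    [set i | val_at (tau j) i = eval (par_at i) (vals_at phi i) (ts j)].
  by rewrite /tau; case: cid2.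
exists (cohesive_apply compA [tuple tau j | j < far f]).
  rewrite [LHS]/(@fint L P f [tuple eval par [tuple of map cls phi] (ts j) | j < far f]).
  have -> : [tuple eval par [tuple of map cls phi] (ts j) | j < far f] =
      [tuple of map cls [tuple tau j | j < far f]].
    by apply: eq_from_tnth => j; rewrite tnth_map !tnth_mktuple.
  exact: cohesive_fintE.
apply: almost_subsetS (almost_subsetI (almost_dom [tuple tau j | j < far f])
  (almost_subset_forall tauC)) => i [/= taui E].
rewrite {1}/val_at /= /apply_at values_at_val //=; apply: (congr1 (@fint L (A i) f)).
by apply: eq_from_tnth => j; rewrite !tnth_mktuple.
Qed.

Lemma clsP (x : P) : exists phi, x = cls phi.
Proof. by exists (repr x); rewrite /cls reprK. Qed.

Lemma cls_eq (phi chi : cohesive_fun A C) :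
  cls phi = cls chi <-> almost_subset C [set i | val_at phi i = val_at chi i].
Proof.
have -> : cls phi = cls chi <->
    almost_subset C [set i | exists2 a, phi i = Some a & chi i = Some a].
  split; first by move/eqmodP/asboolP.
  by move=> h; apply/eqmodP/asboolP.
apply: almost_iff (almost_subsetI (cval_dom phi) (cval_dom chi)) _.
move=> i [/= /val_atE phii /val_atE chii]; rewrite phii chii; split.
  by move=> [a [->] [->]].
by move=> ->; exists (val_at chi i).
Qed.

(** Negation and disjunction need the dichotomy [semidecidable_decided], and existential quantifiers
    need [semidecidable_witness]. A universal formula in $\Sigma_{n+1}$ is already $\Pi_n$, so its
    counterexamples are semidecidable as well. *)
Lemma los m (B : formula L K m) (phi : m.-tuple (cohesive_fun A C)) :
  is_Sigma n.+1 B ->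
  sat par [tuple of map cls phi] B <->
  almost_subset C [set i | sat (par_at i) (vals_at phi i) B].
Proof.
elim: B phi => {m} m.
- move=> t u phi _ /=.
  have [tau -> tauC] := evalE phi t; have [ups -> upsC] := evalE phi u.
  rewrite cls_eq; apply: almost_iff (almost_subsetI tauC upsC) _.
  by move=> i [/= -> ->].
- move=> r ts phi _; rewrite [sat par _ _]/(@rint L P r [tuple eval par
    [tuple of map cls phi] (ts j) | j < rar r]).
  pose tau j := sval (cid2 (evalE phi (ts j))).
  have tauE j : eval par [tuple of map cls phi] (ts j) = cls (tau j).
    by rewrite /tau; case: cid2.
  have tauC j : almost_subset C
      [set i | val_at (tau j) i = eval (par_at i) (vals_at phi i) (ts j)].
    by rewrite /tau; case: cid2.
  have -> : [tuple eval par [tuple of map cls phi] (ts j) | j < rar r] =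
      [tuple of map cls [tuple tau j | j < rar r]].
    by apply: eq_from_tnth => j; rewrite tnth_map !tnth_mktuple.
  apply: (iff_trans (cohesive_rintE compA _)).
  apply: almost_iff (almost_subsetI (almost_dom [tuple tau j | j < rar r])
    (almost_subset_forall tauC)) _ => i [/= taui E].
  rewrite values_at_val //.
  have -> : [tuple val_at (tnth [tuple tau j | j < rar r] j) i | j < rar r] =
      [tuple eval (par_at i) (vals_at phi i) (ts j) | j < rar r].
    by apply: eq_from_tnth => j; rewrite !tnth_mktuple.
  by split=> [[a [<-]]|]; last by exists [tuple eval (par_at i) (vals_at phi i) (ts j) | j < rar r].
- move=> B ih phi SB; have qB : qfree B := (is_Sigma_Pi_prenex _ _).1 SB.
  have [SB' PB'] := qfree_Sigma_Pi n.+1 qB.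
  rewrite /= ih //; split=> [nB|nB B'].
    by case: (semidecidable_decided phi (semidecidable_sigma SB')) => // /nB.
  by apply: almost_consistent B' nB.
- move=> B ih B' ih' phi SB; have /andP [qB qB'] := (is_Sigma_Pi_prenex _ _).1 SB.
  have [SB1 _] := qfree_Sigma_Pi n.+1 qB; have [SB2 _] := qfree_Sigma_Pi n.+1 qB'.
  rewrite /= ih // ih' //; split=> [[h h']|h].
    by apply: almost_subsetS (almost_subsetI h h').
  by split; apply: almost_subsetS h => i [].
- move=> B ih B' ih' phi SB; have /andP [qB qB'] := (is_Sigma_Pi_prenex _ _).1 SB.
  have [SB1 _] := qfree_Sigma_Pi n.+1 qB; have [SB2 _] := qfree_Sigma_Pi n.+1 qB'.
  rewrite /= ih // ih' //; split=> [[h|h]|h].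
  - by apply: almost_subsetS h => i; left.
  - by apply: almost_subsetS h => i; right.
  case: (semidecidable_decided phi (semidecidable_sigma SB1)); first by left.
  move=> h'; right; apply: almost_subsetS (almost_subsetI h h').
  by move=> i [[]].
- move=> B ih phi /is_Sigma_Ex_inv SB /=.
  have consE chi : [tuple of cls chi :: [tuple of map cls phi]] =
      [tuple of map cls [tuple of chi :: phi]] by apply: val_inj.
  have consE' chi i : vals_at [tuple of chi :: phi] i =
      [tuple of val_at chi i :: vals_at phi i] by apply: val_inj.
  split=> [[x]|h].
    have [chi ->] := clsP x; rewrite consE ih //; apply: almost_subsetS => i /=.
    by rewrite consE' => h; exists (val_at chi i).
  have [chi chiC] := semidecidable_witness (semidecidable_sigma SB) h.
  by exists (cls chi); rewrite consE ih.
move=> B ih phi /= SA; have PA := is_Sigma_Pi_notEx SA isT; have PB := is_Pi_All_inv PA.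
have SB : is_Sigma n.+1 B by apply: Sigma_Pi.
have consE chi : [tuple of cls chi :: [tuple of map cls phi]] =
    [tuple of map cls [tuple of chi :: phi]] by apply: val_inj.
have consE' chi i : vals_at [tuple of chi :: phi] i =
    [tuple of val_at chi i :: vals_at phi i] by apply: val_inj.
split=> [h|h x]; last first.
  have [chi ->] := clsP x; rewrite consE ih //; apply: almost_subsetS h => i /= h.
  by rewrite consE'; apply: h.
case: (semidecidable_decided phi (semidecidable_sigma SA)) => // nA.
(* Counterexamples in almost all components are gathered by search into one element [chi], at which
   the formula fails almost everywhere on [C]; yet by assumption the product satisfies it there. *)
exfalso; have {}nA : almost_subset C [set i | exists a,
    ~ sat (par_at i) [tuple of a :: vals_at phi i] B].
  by apply: almost_subsetS nA => i /= /existsNP.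
have [chi chiC] := semidecidable_witness (semidecidable_not_pi PB) nA.
have := h (cls chi); rewrite consE ih // => chiC'.
exact: almost_consistent chiC' chiC.
Qed.

(** * Realizing a computable type *)

Section Realization.
Variables (m : nat) (p : set (formula L K m)).
Hypotheses (typep : is_type par p) (Sigmap : Sigma_type n.+1 p).
Hypothesis compp : computable_type kc p.
Hypothesis D2C : Delta2 C.

Let code x := `[< (gform kc @` p) x >].

                                                                         
                                                                           
                                           
(** Evidence [w] codes three things: a tuple, a stage by which the relevant parameters have
    converged, and a list giving existential witnesses for each formula code. *)
Definition tuple_of w := CodeSeq.decode (nth 0 (CodeSeq.decode w) 0).
Definition time_of w := nth 0 (CodeSeq.decode w) 1.
Definition ex_witness_of w x :=
  CodeSeq.decode (nth 0 (CodeSeq.decode (nth 0 (CodeSeq.decode w) 2)) x).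

(** Carrying stage and witnesses inside [w] makes this relation decidable, although satisfaction of
    $\Sigma_{n+1}$ formulas is only semidecidable. *)
Definition satisfies s i w :=
  [&& size (tuple_of w) == m, all (dm i) (tuple_of w),
      all (fun l => 0 < Psi (time_of w) l i) (iota 0 s) &
      all (fun x => ~~ code x || sigma_check (D i) (dm i) x (tuple_of w)
        (param_codes (time_of w) i x) (ex_witness_of w x)) (iota 0 s)].

Lemma eff_satisfies :
  effective (fun q : nat * (nat * nat) => satisfies q.1 q.2.1 q.2.2).
Proof.
have pcode (T : countType) (f : T -> nat) : effective f -> effective (fun x => code (f x)).
  move=> pf; apply: eff_of_pickle.
  exact: (eff_unary (f := fun x => `[< (gform kc @` p) x >] : nat)).
rewrite /satisfies /tuple_of /time_of /ex_witness_of; eff.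
- by apply: eff_all; eff; apply: eff_dom; eff.
- by apply: eff_all; eff; apply: (eff_app3 effPsi); eff.
- apply: eff_all; eff; first by apply: pcode; eff.
  by apply: eff_sigma_check; eff; apply: eff_param_codes; eff.
Qed.

Lemma satisfies_dec s s' i w : s <= s' -> satisfies s' i w -> satisfies s i w.
Proof.
have sub (a : pred nat) : s <= s' -> all a (iota 0 s') -> all a (iota 0 s).
  move=> ss' /allP h; apply/allP => x xs; apply: h.
  by move: xs; rewrite !mem_iota /= !add0n => /leq_trans; apply.
by move=> ss' /and4P [sz dw h h']; rewrite /satisfies sz dw !(sub _ ss').
Qed.

(** The product satisfies the finitely many formulas of [p] with code below [s] at some tuple. By
    [los] they hold at its coordinates almost everywhere on [C], where evidence can then be
    assembled. *)
Lemma almost_satisfied s :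
  almost_subset C [set i | exists w, satisfies s i w].
Proof.
have fin : finite_set [set B | p B /\ gform kc B < s].
  apply: (@sub_finite_set _ _ (gform kc @^-1` `I_s)); first by move=> B [].
  apply: finite_preimage; last exact: finite_II.
  by move=> B B' _ _; apply: gform_inj.
have [//|a aP] := typep fin; first by move=> B [].
pose phi := [tuple of map (fun x => sval (cid (clsP x))) a].
have aE : a = [tuple of map cls phi].
  apply: eq_from_tnth => j; rewrite !tnth_map.
  exact: (svalP (cid (clsP (tnth a j)))).
have satC (x : 'I_s) : almost_subset C [set i | forall B, p B -> gform kc B = x ->
    sat (par_at i) (vals_at phi i) B].
  have [[B pB Bx]|nB] := pselect (exists2 B, p B & gform kc B = x); last first.
    by apply: almost_subsetS almost_setT => i _ B pB Bx; case: nB; exists B.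
  have : sat par a B by apply: aP; rewrite /= Bx.
  rewrite aE los; last exact: Sigmap.
  apply: almost_subsetS => i h B' pB' B'x.
  by rewrite (@gform_inj _ _ _ kc_inj _ B' B) // B'x.
apply: almost_subsetS (almost_subsetI (almost_params s) (almost_subset_forall satC)).
move=> i [/= psii Bi]; have [t tP] := Psi_ready psii.
(* Existential witnesses for the formula coded by [x]; at the remaining [x] any list will do. *)
have ysP (x : nat) : exists ys, x < s -> code x ->
    sigma_check (D i) (dm i) x (map (@value L (A i)) (vals_at phi i))
      (param_codes t i x) ys.
  have [xs|] := boolP (x < s); last by exists [::].
  have [/asboolP [B pB Bx]|] := boolP (code x); last by exists [::].
  have tx l : l < x -> 0 < Psi t l i by move=> lx; apply/tP/(ltn_trans lx).
  have hp := param_codesE tx; rewrite -Bx in hp.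
  have [ys h] := (sigma_checkP (vals_at phi i) (Sigmap pB) hp).2
    (Bi (Ordinal xs) B pB Bx).
  by exists ys => _ _; rewrite -Bx.
pose ys x := sval (cid (ysP x)).
exists (CodeSeq.code [:: CodeSeq.code (map (@value L (A i)) (vals_at phi i)); t;
  CodeSeq.code (mkseq (fun x => CodeSeq.code (ys x)) s)]).
rewrite /satisfies /tuple_of /time_of /ex_witness_of !CodeSeq.codeK /=.
rewrite !size_map size_tuple eqxx /=; apply/and3P; split.
- by apply/allP => _ /mapP [y _ ->]; apply: (svalP y).
- by apply/allP => l; rewrite mem_iota; apply: tP.
apply/allP => x; rewrite mem_iota add0n /= => xs.
rewrite nth_mkseq // CodeSeq.codeK -implybE; apply/implyP => cx.
exact: (svalP (cid (ysP x))).
Qed.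

(** The coordinates of the tuples chosen by [uniformization] are partial computable functions, and
    their classes realize [p] by the converse direction of [los]. *)
Lemma type_realized : realized par p.
Proof.
have [v pv [v0 vC]] := uniformization D2C cohC eff_satisfies satisfies_dec almost_satisfied.
have vdef : almost_subset C [set i | v i].
  by apply: almost_subsetS (vC 0) => i /= [w ->].
have chi_ex (j : 'I_m) : exists chi : cohesive_fun A C, forall i w, v i = Some w ->
    value (val_at chi i) = nth 0 (tuple_of w) j.
  have [||||chi chiE] := @cohesive_fun_of v (fun _ w => nth 0 (tuple_of w) j) => //.
  - by rewrite /tuple_of; eff.
  - move=> i w /v0 /and4P [/eqP sz /allP dw _ _]; apply: dw.
    by apply: mem_nth; rewrite sz.
  by exists chi.
pose phi := [tuple sval (cid (chi_ex j)) | j < m].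
have phiE i w : v i = Some w -> map (@value L (A i)) (vals_at phi i) = tuple_of w.
  move=> vi; have /v0 /and4P [/eqP sz _ _ _] := vi.
  apply: (@eq_from_nth _ 0); first by rewrite size_map size_tuple sz.
  rewrite size_map size_tuple => j jm.
  rewrite -(svalP (cid (chi_ex (Ordinal jm))) i w vi).
  rewrite (nth_map (default i)) ?size_tuple // -(tnth_nth _ _ (Ordinal jm)).
  by rewrite tnth_map tnth_mktuple.
exists [tuple of map cls phi] => B pB; apply/los; first exact: Sigmap.
(* The successor is needed because [satisfies s] covers the codes strictly below [s]. *)
apply: almost_subsetS (vC (gform kc B).+1) => i [w vi].
move=> /and4P [_ _ /allP Psip /allP /(_ (gform kc B))].
rewrite mem_iota add0n ltnSn => /(_ isT).
have -> : code (gform kc B) by apply/asboolP; exists B.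
move=> /= h; have hp := @param_codesE (time_of w) i (gform kc B).
apply/(sigma_checkP (vals_at phi i) (Sigmap pB) (hp _)) => [l lB|].
  by apply: Psip; rewrite mem_iota add0n /= ltnW.
by exists (ex_witness_of w (gform kc B)); rewrite (phiE _ _ vi).
Qed.

End Realization.

End ParameterizedTypes.
End Los.

(** * Uniform and finite sequences of parameters *)

Section Saturation.
Variables (L : language) (n : nat) (A : nat -> nat_structure L) (C : set nat).
Hypothesis compA : uniformly_computable A.
Hypothesis decA : computable_rel (binary (fun i => elementary_diagram n (A i))).
Hypotheses (D2C : Delta2 C) (cohC : cohesive C).

Let P : structure L := cohesive_product C compA.

Lemma product_realizes_types (e : nat -> P) : uniformly_partial_computable e ->
  realizes_computable_Sigma_types n.+1 id e.
Proof.
move=> [psi eE ppsi] m p typep Sigmap compp.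
have [F [pF FS FE]] := approximation ppsi.
apply: (@type_realized _ _ _ _ compA decA cohC psi (fun t l i => F t [:: l; i]))
  typep Sigmap compp D2C => //.
- by apply: (eff_app2 pF); eff.
- by move=> t t' l i y; apply: FS.
- by move=> l i y; rewrite -(FE [tuple l; i]).
Qed.

(** Finitely many representatives always form a uniformly partial computable sequence: each has an
    approximation, and a finite case distinction on the index joins them. Beyond [N] the sequence is
    filled with an arbitrary element [chi0]. *)
Lemma product_saturated : Sigma_recursively_saturated P n.+1.
Proof.
move=> N par m p typep Sigmap compp.
have [chi0] := cohesive_fun_inhabited C compA.
pose rep (j : 'I_N) : cohesive_fun A C := repr (par j : cohesive_carrier A C).
pose psi l := if insub l is Some j then rep j else chi0.
have [F0 [pF0 F0S F0E]] := approximation (cval_pc chi0).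
pose F j := sval (cid (approximation (cval_pc (rep j)))).
have hF j : approximates (F j) (unary (fun i => omap (@value L (A i)) (rep j i))).
  exact: (svalP (cid (approximation (cval_pc (rep j))))).
(* Written as a fold over a fixed list, the case distinction is effective in [l] although the [F j]
   were chosen individually. *)
pose G s t l i := foldr (fun (j : 'I_N) r => if l == j :> nat then F j t [:: i] else r)
  (F0 t [:: i]) s.
have GE l : (exists2 j, psi l = rep j &
      forall t i, G (enum 'I_N) t l i = F j t [:: i]) \/
    (psi l = chi0 /\ forall t i, G (enum 'I_N) t l i = F0 t [:: i]).
  rewrite /psi; case: insubP => [j _ jl|lN].
    left; exists j => // t i; have := mem_enum 'I_N j; rewrite inE.
    elim: (enum _) => // j' s ih; rewrite inE [G _ _ _ _]/=.
    have [lj|lj] := eqVneq l (j' : nat).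
      by have -> : j' = j by apply/val_inj; rewrite jl.
    by case/predU1P => [jj|/ih //]; rewrite -jl jj eqxx in lj.
  right; split=> // t i; rewrite /G; elim: (enum _) => //= j s ->.
  by case: eqP => // lj; rewrite lj ltn_ord in lN.
apply: (@type_realized _ _ _ _ compA decA cohC psi (G (enum 'I_N)))
  typep Sigmap compp D2C => //.
- rewrite /G; elim: (enum _) => [|j s ih] /=; first by apply: (eff_app2 pF0); eff.
  by apply: eff_if => //; eff; have [pF _ _] := hF j; apply: (eff_app2 pF); eff.
- move=> t t' l i y; have [[j _ GF]|[_ GF]] := GE l; rewrite !GF; last exact: F0S.
  by have [_ FS _] := hF j; apply: FS.
- move=> l i y; have [[j -> GF]|[-> GF]] := GE l; last first.
    by rewrite (F0E [tuple i]); split=> -[t h]; exists t; rewrite ?GF // -GF.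
  have [_ _ FE] := hF j.
  by rewrite (FE [tuple i]); split=> -[t h]; exists t; rewrite ?GF // -GF.
- exact: val_inj.
- by move=> j; rewrite /psi valK reprK.
Qed.

End Saturation.

Theorem theorem2p6 (L : language) (C : set nat) (n : nat) :
  computable_language L -> Delta2 C -> cohesive C ->
  (forall (A : nat -> nat_structure L) (hA : uniformly_n_decidable n A),
     let P := cohesive_product C (proj1 hA) in
     (forall e : nat -> P, uniformly_partial_computable e ->
        realizes_computable_Sigma_types n.+1 id e) /\
     Sigma_recursively_saturated P n.+1) /\
  (forall (A : nat_structure L) (hA : n_decidable n A),
     let P := cohesive_power C (proj1 hA) in
     (forall e : nat -> P, uniformly_partial_computable e ->
        realizes_computable_Sigma_types n.+1 id e) /\
     Sigma_recursively_saturated P n.+1).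
Proof.
move=> _ D2C cohC; split=> A hA.
  split=> [e|]; [apply: product_realizes_types | apply: product_saturated] => //;
    exact: (proj2 hA).
(* A cohesive power is the product of a constant sequence, whose diagrams are uniformly
   decidable. *)
have decA : computable_rel (binary (fun=> elementary_diagram n A)).
  have := proj2 hA; rewrite /computable_rel => pd.
  apply: (computable_unary (f := fun x => `[< elementary_diagram n A x >] : nat)) => //.
  exact: computable_proj.
by split=> [e|]; [apply: product_realizes_types | apply: product_saturated].
Qed.
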